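(* Let $d \geq 2$ be an integer and let $\tau_1,\ldots,\tau_d$ be real numbers in $]0,1[$ such that $\tau_1 + \cdots + \tau_d < 1$. Let $\rho_1,\ldots,\rho_d \in \mathbb{R}/\mathbb{Z}$ be independent over the rationals. Then there exist pairwise commuting circle diffeomorphisms $f_1,\ldots,f_d$ such that, for each $k \in \{1,\ldots,d\}$, $f_k$ is of class $C^{1+\tau_k}$ and has rotation number $\rho_k$, and none of the $f_k$ is topologically conjugate to a rotation.
   Context: Circle diffeomorphisms are orientation preserving. A map is of class $C^{1+\tau}$ ($0<\tau<1$) if it is $C^1$ and its derivative is $\tau$-Hölder continuous. Elements $\rho_1,\ldots,\rho_d \in \mathbb{R}/\mathbb{Z}$ are independent over the rationals if no nontrivial linear combination of them with rational coefficients equals a rational number. *)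

(* Defs.v *)
From Stdlib Require Import Reals QArith.
From Coquelicot Require Import Coquelicot.
Open Scope R_scope.

(* Circle R/Z; maps of the circle are represented by their lifts R -> R. *)

Definition circle_diffeo_lift (F : R -> R) : Prop :=
  (forall x, F (x + 1) = F x + 1) /\
  (forall x, ex_derive F x) /\
  (forall x, continuous (Derive F) x) /\
  (forall x, 0 < Derive F x).

Definition holder_deriv (tau : R) (F : R -> R) : Prop :=
  exists C : R, forall x y, x <> y ->
    Rabs (Derive F x - Derive F y) <= C * Rpower (Rabs (x - y)) tau.

Definition circle_commute (F G : R -> R) : Prop :=
  forall x, exists m : Z, F (G x) = G (F x) + IZR m.

Definition has_rotation_number (F : R -> R) (rho : R) : Prop :=
  exists s : R, (exists k : Z, s = rho + IZR k) /\
    forall x, is_lim_seq (fun n => (Nat.iter n F x - x) / INR n) s.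

Definition circle_homeo_lift (H : R -> R) : Prop :=
  (forall x, continuous H x) /\
  (forall x y, H x = H y -> x = y) /\
  (forall y, exists x, H x = y) /\
  ((forall x, H (x + 1) = H x + 1) \/ (forall x, H (x + 1) = H x - 1)).

Definition conj_to_rotation (F : R -> R) : Prop :=
  exists (H : R -> R) (alpha : R), circle_homeo_lift H /\
    forall x, exists m : Z, H (F x) = H x + alpha + IZR m.

Fixpoint sumR (n : nat) (a : nat -> R) : R :=
  match n with O => 0 | S k => sumR k a + a k end.

(* rho_0..rho_{d-1} (representatives in R of elements of R/Z) are independent
   over Q: no nontrivial rational combination is a rational number. *)
Definition rat_independent (d : nat) (rho : nat -> R) : Prop :=
  forall q : nat -> Q, (exists i, (i < d)%nat /\ ~ (q i == 0)%Q) ->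
    forall p : Q, sumR d (fun i => Q2R (q i) * rho i) <> Q2R p.

(* Main.v *)
(** Denjoy's construction for the free action of [Z^d] on the circle by the
    rotations of angles [rho_k].  The point [sum_j i_j rho_j] is blown up into
    an interval of length proportional to [1 / sum_j (1 + |i_j|)^(1/tau_j)];
    the total length is finite because [1/size <= prod_j (1 + |i_j|)^(-s)] with
    [s = 1 / sum_j tau_j > 1].  The blown-up line consists of pairs [(t, u)]
    with [0 <= u <= w t], and [f_k] maps [(t, u)] to [(t + rho_k, phi u)] where
    the diffeomorphisms [phi = transit a b : [0,a] -> [0,b]] compose like their
    endpoints, so that the [f_k] commute.  Since
    [|w (t + rho_k) - w t| <= C (w t)^(1 + tau_k)], one gets the uniform Taylor
    estimate [|f y - f x - g x (y - x)| <= C |y - x|^(1 + tau_k)]; exchanging [x]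
    and [y] in it shows that [g = f'] is [tau_k]-Hoelder.  The lengths of the
    iterates of a blown-up interval tend to 0 along a subsequence, which is
    impossible for a conjugate of a rotation. *)

Require Import Defs.
From Stdlib Require Import Reals QArith.
From Coquelicot Require Import Coquelicot.
From Stdlib Require Import ZArith Lra Lia List ClassicalEpsilon.
Open Scope R_scope.

(** * Sums over finite lists and masses of sets of reals *)

(** The exponents [1 / tau_j] come from scaling. A unit step along axis k changes |i_k|^(1/tau_k) by
    about |i_k|^(1/tau_k - 1), which is at most a constant times size^(1 - tau_k); the relative
    change of a length is therefore of order length^(tau_k), which is what a C^(1 + tau_k) map with
    derivative 1 at both ends of a gap allows. Independence over the rationals makes the index of an
    orbit point unique, so that the length attached to it is well defined. The obstacle is
    regularity on the set left between the gaps, where the map is given by no formula: the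
    derivative there has to be 1, and only total lengths of gaps can be compared. A point off the
    orbit is treated as a gap of length 0, so that a single estimate covers all points. The line
    being blown up carries a multiple of Lebesgue measure besides the atoms; total atomic mass at
    most 1/2 keeps that multiple positive. The Lebesgue part separates distinct gaps strictly and,
    being translation invariant, adds no error. *)

Definition lsum {A : Type} (f : A -> R) (l : list A) : R :=
  fold_right (fun a s => f a + s) 0 l.

Lemma lsum_app {A} (f : A -> R) l l' : lsum f (l ++ l') = lsum f l + lsum f l'.
Proof. induction l as [|a l IH]; simpl; [lra | rewrite IH; lra]. Qed.

Lemma lsum_map {A B} (f : B -> R) (g : A -> B) l :
  lsum f (map g l) = lsum (fun a => f (g a)) l.
Proof. induction l as [|a l IH]; simpl; [lra | rewrite IH; lra]. Qed.

Lemma lsum_scal {A} (c : R) (f : A -> R) l : lsum (fun a => c * f a) l = c * lsum f l.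
Proof. induction l as [|a l IH]; simpl; [lra | rewrite IH; lra]. Qed.

Lemma lsum_le {A} (f g : A -> R) l :
  (forall a, In a l -> f a <= g a) -> lsum f l <= lsum g l.
Proof.
  induction l as [|a l IH]; simpl; intros H; [lra|].
  pose proof (H a (or_introl eq_refl)). assert (lsum f l <= lsum g l) by auto. lra.
Qed.

Lemma lsum_ge0 {A} (f : A -> R) l : (forall a, In a l -> 0 <= f a) -> 0 <= lsum f l.
Proof.
  induction l as [|a l IH]; simpl; intros H; [lra|].
  pose proof (H a (or_introl eq_refl)). assert (0 <= lsum f l) by auto. lra.
Qed.

Lemma lsum_incl {A} (f : A -> R) l l' :
  (forall a, In a l' -> 0 <= f a) -> NoDup l -> incl l l' -> lsum f l <= lsum f l'.
Proof.
  revert l'. induction l as [|a l IH]; intros l' Hf Hl Hi.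
  - apply lsum_ge0; auto.
  - inversion Hl as [|? ? Ha Hl']; subst.
    destruct (in_split a l' (Hi a (or_introl eq_refl))) as (l1 & l2 & ->).
    assert (lsum f l <= lsum f (l1 ++ l2)).
    { apply IH; auto.
      - intros b Hb. apply Hf. apply in_app_or in Hb. apply in_or_app. simpl. tauto.
      - intros b Hb. pose proof (Hi b (or_intror Hb)) as Hb'.
        apply in_app_or in Hb'. apply in_or_app. simpl in Hb'.
        destruct Hb' as [|[->|]]; tauto. }
    rewrite lsum_app in *. simpl. lra.
Qed.

Lemma lsum_term {A} (f : A -> R) l a :
  (forall a, In a l -> 0 <= f a) -> In a l -> f a <= lsum f l.
Proof.
  intros Hf Ha. replace (f a) with (lsum f (a :: nil)) by (simpl; lra).
  apply lsum_incl; auto.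
  - constructor; [intros [] | constructor].
  - intros b [->|[]]; auto.
Qed.

Definition summable (v : R -> R) (A : R -> Prop) : Prop :=
  exists B, forall L, NoDup L -> (forall p, In p L -> A p) -> lsum v L <= B.

(* A weight [v >= 0] is treated as the purely atomic measure [sum_p v p delta_p];
   the value is junk when [v] is not summable on [A]. *)
Definition mass (v : R -> R) (A : R -> Prop) : R :=
  real (Lub_Rbar (fun z => exists L, NoDup L /\ (forall p, In p L -> A p) /\ z = lsum v L)).

Lemma mass_spec v A : summable v A ->
  (forall L, NoDup L -> (forall p, In p L -> A p) -> lsum v L <= mass v A) /\
  (forall B, (forall L, NoDup L -> (forall p, In p L -> A p) -> lsum v L <= B) ->
     mass v A <= B).
Proof.
  intros [B0 HB0]. unfold mass.
  set (E := fun z => _).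
  destruct (Lub_Rbar_correct E) as [Hub Hleast].
  assert (HE : E 0).
  { exists nil. split; [constructor|]. split; [intros p []|]. reflexivity. }
  assert (Hle : Rbar_le (Lub_Rbar E) B0).
  { apply Hleast. intros z (L & H1 & H2 & ->). simpl. auto. }
  pose proof (Hub 0 HE) as Hge.
  destruct (Lub_Rbar E) as [m| |]; simpl in *; try contradiction.
  split.
  - intros L H1 H2. apply (Hub (lsum v L)). exists L. auto.
  - intros B HB. apply (Hleast (Finite B)). intros z (L & H1 & H2 & ->). simpl. auto.
Qed.

Lemma mass_ub v A L : summable v A ->
  NoDup L -> (forall p, In p L -> A p) -> lsum v L <= mass v A.
Proof. intros H. apply (proj1 (mass_spec v A H)). Qed.

Lemma mass_least v A B :
  (forall L, NoDup L -> (forall p, In p L -> A p) -> lsum v L <= B) -> mass v A <= B.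
Proof. intros H. apply (proj2 (mass_spec v A (ex_intro _ B H))). exact H. Qed.

Lemma mass_ge0 v A : summable v A -> 0 <= mass v A.
Proof. intros H. apply (mass_ub v A nil H); [constructor | intros p []]. Qed.

Lemma summable_sub v A A' : (forall p, A p -> A' p) -> summable v A' -> summable v A.
Proof. intros H [B HB]. exists B. auto. Qed.

Lemma mass_ext v v' A A' :
  (forall p, v p = v' p) -> (forall p, A p <-> A' p) -> mass v A = mass v' A'.
Proof.
  intros Hv HA. unfold mass. f_equal. apply Lub_Rbar_eqset. intros z.
  assert (Hl : forall L, lsum v L = lsum v' L).
  { induction L as [|a L IH]; simpl; [lra | rewrite Hv, IH; lra]. }
  split; intros (L & H1 & H2 & ->); exists L;
    (split; [auto|split; [intros p Hp; apply HA; auto | auto]]).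
Qed.

Lemma mass_approx v A eps : summable v A -> 0 < eps ->
  exists L, NoDup L /\ (forall p, In p L -> A p) /\ mass v A - eps < lsum v L.
Proof.
  intros HS He. apply NNPP. intros HN.
  assert (mass v A <= mass v A - eps); [|lra].
  apply mass_least. intros L H1 H2. apply Rnot_lt_le. intros Hlt.
  apply HN. exists L. auto.
Qed.

(** [A] is an arbitrary proposition, so excluded middle takes the place of a boolean filter. *)
Lemma lsum_partition v (A : R -> Prop) L : NoDup L -> exists L1 L2,
  NoDup L1 /\ NoDup L2 /\ (forall p, In p L1 -> In p L /\ A p) /\
  (forall p, In p L2 -> In p L /\ ~ A p) /\ lsum v L = lsum v L1 + lsum v L2.
Proof.
  induction L as [|a L IH]; intros HL.
  - exists nil, nil. repeat split; try constructor; simpl in *; try tauto. lra.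
  - inversion HL as [|? ? Ha HL']; subst.
    destruct (IH HL') as (L1 & L2 & N1 & N2 & H1 & H2 & E).
    destruct (classic (A a)) as [Aa|Aa].
    + exists (a :: L1), L2. repeat split; simpl; auto; try (rewrite E; lra).
      * constructor; auto. intros Hin. apply Ha. apply H1. exact Hin.
      * destruct H as [->|H]; auto. right. apply H1. exact H.
      * destruct H as [->|H]; auto. apply H1. exact H.
      * right. apply H2. exact H.
      * apply H2. exact H.
    + exists L1, (a :: L2). repeat split; simpl; auto; try (rewrite E; lra).
      * constructor; auto. intros Hin. apply Ha. apply H2. exact Hin.
      * right. apply H1. exact H.
      * apply H1. exact H.
      * destruct H as [->|H]; auto. right. apply H2. exact H.
      * destruct H as [->|H]; auto. apply H2. exact H.
Qed.

Lemma summable_union v A B : summable v A -> summable v B ->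
  summable v (fun p => A p \/ B p).
Proof.
  intros [KA HA] [KB HB]. exists (KA + KB). intros L HL HAB.
  destruct (lsum_partition v A L HL) as (L1 & L2 & N1 & N2 & H1 & H2 & ->).
  apply Rplus_le_compat.
  - apply HA; auto. intros p Hp. apply H1. exact Hp.
  - apply HB; auto. intros p Hp. destruct (H2 p Hp) as [Hin Hn].
    destruct (HAB p Hin); tauto.
Qed.

Lemma mass_union v A B C : summable v C ->
  (forall p, C p <-> A p \/ B p) -> (forall p, A p -> ~ B p) ->
  mass v C = mass v A + mass v B.
Proof.
  intros HC HU HD.
  assert (HA : summable v A) by (apply summable_sub with C; firstorder).
  assert (HB : summable v B) by (apply summable_sub with C; firstorder).
  apply Rle_antisym.
  - apply mass_least. intros L HL HLC.
    destruct (lsum_partition v A L HL) as (L1 & L2 & N1 & N2 & H1 & H2 & ->).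
    apply Rplus_le_compat; apply mass_ub; auto.
    + intros p Hp. apply H1. exact Hp.
    + intros p Hp. destruct (H2 p Hp) as [Hin Hn]. apply HLC, HU in Hin. tauto.
  - assert (mass v A <= mass v C - mass v B); [|lra].
    apply mass_least. intros L HL HLA.
    assert (mass v B <= mass v C - lsum v L); [|lra].
    apply mass_least. intros L' HL' HLB.
    assert (lsum v (L ++ L') <= mass v C); [|rewrite lsum_app in *; lra].
    apply mass_ub; auto.
    + apply NoDup_app; auto. intros p Hp Hp'. exact (HD p (HLA p Hp) (HLB p Hp')).
    + intros p Hp. apply HU. apply in_app_or in Hp. destruct Hp; auto.
Qed.

Lemma mass_translate v A r :
  mass (fun p => v (p + r)) (fun p => A (p + r)) = mass v A.
Proof.
  unfold mass. f_equal. apply Lub_Rbar_eqset. intros z.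
  split; intros (L & H1 & H2 & ->).
  - exists (map (fun p => p + r) L). split; [|split].
    + apply NoDup_map_NoDup_ForallPairs; auto. intros x y _ _ E. lra.
    + intros p Hp. apply in_map_iff in Hp. destruct Hp as (q & <- & Hq). auto.
    + rewrite lsum_map. reflexivity.
  - exists (map (fun p => p - r) L). split; [|split].
    + apply NoDup_map_NoDup_ForallPairs; auto. intros x y _ _ E. lra.
    + intros p Hp. apply in_map_iff in Hp. destruct Hp as (q & <- & Hq).
      replace (q - r + r) with q by lra. auto.
    + rewrite lsum_map. clear. induction L as [|a L IH]; simpl; [lra|].
      rewrite IH. replace (a - r + r) with a by lra. lra.
Qed.

Lemma mass_singleton v a : 0 <= v a -> mass v (fun p => p = a) = v a.
Proof.
  intros Hv.
  assert (HB : forall L, NoDup L -> (forall p, In p L -> p = a) -> lsum v L <= v a).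
  { intros L HL Ha. replace (v a) with (lsum v (a :: nil)) by (simpl; lra).
    apply lsum_incl; auto.
    - intros b [<-|[]]. exact Hv.
    - intros b Hb. left. symmetry. auto. }
  apply Rle_antisym.
  - apply mass_least. exact HB.
  - replace (v a) with (lsum v (a :: nil)) by (simpl; lra).
    apply mass_ub.
    + exists (v a). exact HB.
    + constructor; [intros []|constructor].
    + intros p [->|[]]. reflexivity.
Qed.

(** * Lifts of circle homeomorphisms and conjugacy to rotations *)

(** The increment is a parameter because several values occur: 0 for the weight, 1 for [jump], 1 or
    -1 for conjugacies according to their orientation. *)
Lemma quasiperiodic_IZR (f : R -> R) s : (forall z, f (z + 1) = f z + s) ->
  forall (n : Z) z, f (z + IZR n) = f z + s * IZR n.
Proof.
  intros Hf.
  assert (Hn : forall (k : nat) z, f (z + INR k) = f z + s * INR k).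
  { induction k as [|k IH]; intros z.
    - simpl. rewrite Rplus_0_r. ring.
    - rewrite S_INR, <- Rplus_assoc, Hf, IH. ring. }
  intros n z. destruct (Z_le_gt_dec 0 n) as [H|H].
  - rewrite <- (Z2Nat.id n H), <- INR_IZR_INZ. apply Hn.
  - assert (E : IZR n = - INR (Z.to_nat (- n))).
    { rewrite INR_IZR_INZ, Z2Nat.id, opp_IZR by lia. ring. }
    rewrite E. pose proof (Hn (Z.to_nat (- n)) (z + - INR (Z.to_nat (- n)))) as H'.
    replace (z + - INR (Z.to_nat (- n)) + INR (Z.to_nat (- n))) with z in H' by ring.
    lra.
Qed.

Lemma frac_part_eq x y : frac_part x = frac_part y -> -1 < x - y < 1 -> x = y.
Proof.
  unfold frac_part. intros E H.
  assert (E' : x - y = IZR (Int_part x - Int_part y)) by (rewrite minus_IZR; lra).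
  rewrite E' in H.
  assert (Int_part x - Int_part y = 0)%Z as E0.
  { destruct H as [H1 H2]. apply (lt_IZR (-1)) in H1. apply (lt_IZR _ 1) in H2. lia. }
  rewrite E0 in E'. simpl in E'. lra.
Qed.

Lemma near_integers_integer x :
  (forall eps, 0 < eps -> exists k : Z, Rabs (x - IZR k) < eps) -> exists k : Z, x = IZR k.
Proof.
  intros H. exists (Int_part x). pose proof (Rplus_Int_part_frac_part x) as E.
  destruct (base_fp x) as [H0 H1]. set (f := frac_part x) in *. clearbody f.
  destruct (Rle_lt_or_eq_dec 0 f) as [Hf|Hf]; [lra| |lra]. exfalso.
  destruct (H (Rmin f (1 - f))) as [k Hk]; [apply Rmin_glb_lt; lra|].
  pose proof (Rmin_l f (1 - f)). pose proof (Rmin_r f (1 - f)).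
  apply Rabs_lt_between in Hk.
  assert (A1 : IZR (Int_part x) < IZR k) by lra.
  assert (A2 : IZR k < IZR (Int_part x + 1)) by (rewrite plus_IZR; lra).
  apply lt_IZR in A1, A2. lia.
Qed.

Lemma circle_homeo_lift_IZR H : circle_homeo_lift H -> exists s : Z,
  (s * s = 1)%Z /\ forall (n : Z) z, H (z + IZR n) = H z + IZR (s * n).
Proof.
  intros (_ & _ & _ & [H1|H1]).
  - exists 1%Z. split; [reflexivity|]. intros n z. rewrite mult_IZR.
    apply quasiperiodic_IZR. exact H1.
  - exists (-1)%Z. split; [reflexivity|]. intros n z. rewrite mult_IZR.
    apply quasiperiodic_IZR. intros u. rewrite H1. lra.
Qed.

Lemma circle_homeo_lift_unif_cont H eps : circle_homeo_lift H -> 0 < eps ->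
  exists delta, 0 < delta /\ forall x y, Rabs (x - y) < delta -> Rabs (H x - H y) < eps.
Proof.
  intros HH He. destruct (circle_homeo_lift_IZR H HH) as (s & _ & Hs).
  destruct HH as (Hc & _).
  (* An integer translation puts [x] in [0, 1); with [delta] at most 1, [y] then stays in [-1, 2],
     where Heine's theorem applies. *)
  assert (Hp : forall x, -1 <= x <= 2 -> continuity_pt H x).
  { intros x _. apply continuity_pt_filterlim, Hc. }
  destruct (Heine_cor2 Hp (mkposreal eps He)) as [delta Hd].
  exists (Rmin delta 1). split; [apply Rmin_glb_lt; [apply cond_pos | lra]|].
  intros x y Hxy. pose proof (Rmin_l delta 1). pose proof (Rmin_r delta 1).
  destruct (base_Int_part x) as [B1 B2]. set (n := Int_part x) in *.
  pose proof (Rabs_lt_between (x - y) (Rmin delta 1)) as [Hb _]. specialize (Hb Hxy).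
  specialize (Hd (x - IZR n) (y - IZR n)). simpl in Hd.
  replace x with (x - IZR n + IZR n) by ring.
  replace y with (y - IZR n + IZR n) by ring. rewrite !Hs.
  replace (H (x - IZR n) + IZR (s * n) - (H (y - IZR n) + IZR (s * n)))
    with (H (x - IZR n) - H (y - IZR n)) by ring.
  apply Hd; try lra. replace (x - IZR n - (y - IZR n)) with (x - y) by ring. lra.
Qed.

Lemma conj_to_rotation_iter f H a : (forall x : R, exists m : Z, H (f x) = H x + a + IZR m) ->
  forall n x, exists m : Z, H (Nat.iter n f x) = H x + INR n * a + IZR m.
Proof.
  intros Hf n x. induction n as [|n [m IH]].
  - exists 0%Z. simpl. ring.
  - destruct (Hf (Nat.iter n f x)) as [k Hk]. exists (m + k)%Z.
    rewrite Nat.iter_succ, Hk, IH, S_INR, plus_IZR. ring.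
Qed.

(** Under a conjugacy [H] to a rotation, [H y - H x] is constant modulo integers along the orbit.
    Uniform continuity of [H] brings it arbitrarily close to integers, so it is an integer, and
    injectivity of [H] makes [y - x] an integer as well. *)
Lemma proximal_not_conj_to_rotation f x y : 0 < y - x < 1 ->
  (forall eps, 0 < eps -> exists n, Rabs (Nat.iter n f y - Nat.iter n f x) < eps) ->
  ~ conj_to_rotation f.
Proof.
  intros Hxy Hprox (H & a & HH & Hf).
  destruct (near_integers_integer (H y - H x)) as [k Hk].
  { intros eps He.
    destruct (circle_homeo_lift_unif_cont H eps HH He) as (delta & Hd & Hu).
    destruct (Hprox delta Hd) as [n Hn]. apply Hu in Hn.
    destruct (conj_to_rotation_iter f H a Hf n x) as [m1 E1].
    destruct (conj_to_rotation_iter f H a Hf n y) as [m2 E2].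
    exists (m1 - m2)%Z. rewrite minus_IZR.
    replace (H y - H x - (IZR m1 - IZR m2)) with (H (Nat.iter n f y) - H (Nat.iter n f x))
      by lra. exact Hn. }
  destruct (circle_homeo_lift_IZR H HH) as (s & Hss & Hs).
  destruct HH as (_ & Hinj & _).
  assert (E : y = x + IZR (s * k)).
  { apply Hinj. rewrite Hs, Z.mul_assoc, Hss, Z.mul_1_l. lra. }
  assert (A : 0 < IZR (s * k) < 1) by lra. destruct A as [A1 A2].
  apply lt_IZR in A1. apply (lt_IZR _ 1) in A2. lia.
Qed.

(** * Taylor estimates and the equivariant family of interval diffeomorphisms *)

Definition taylor_error (f g : R -> R) x y := Rabs (f y - f x - g x * (y - x)).

(** Adding the expansions at [x] and at [y] cancels the values of [f] and leaves (g x - g y)(y - x)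
    up to sign. *)
Lemma taylor_error_deriv f g x y E :
  taylor_error f g x y <= E -> taylor_error f g y x <= E ->
  Rabs (g x - g y) * Rabs (y - x) <= 2 * E.
Proof.
  unfold taylor_error. intros H1 H2. rewrite <- Rabs_mult.
  apply Rabs_le_between in H1, H2. apply Rabs_le. nra.
Qed.

(** No constant is lost when [m] lies between [u] and [v]: the estimate |g u - g m| <= 2 K |m - u|
    contributes the cross term that completes (m - u)^2 + (v - m)^2 to the square of v - u. *)
Lemma taylor_error_glue f g K u m v : 0 <= K -> 0 <= (m - u) * (v - m) ->
  taylor_error f g u m <= K * (m - u) ^ 2 ->
  taylor_error f g m u <= K * (u - m) ^ 2 ->
  taylor_error f g m v <= K * (v - m) ^ 2 ->
  taylor_error f g u v <= K * (v - u) ^ 2.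
Proof.
  intros HK Hs H1 H2 H3.
  assert (Hg : Rabs (g u - g m) <= 2 * K * Rabs (m - u)).
  { destruct (Req_dec m u) as [->|Hne].
    - rewrite !Rminus_diag, Rabs_R0. lra.
    - replace ((u - m) ^ 2) with ((m - u) ^ 2) in H2 by ring.
      pose proof (taylor_error_deriv f g u m _ H1 H2) as H.
      rewrite <- (pow2_abs (m - u)) in H.
      assert (0 < Rabs (m - u)) by (apply Rabs_pos_lt; lra).
      apply Rmult_le_reg_r with (Rabs (m - u)); auto. nra. }
  unfold taylor_error in *.
  replace (f v - f u - g u * (v - u)) with
    ((f v - f m - g m * (v - m)) + (f m - f u - g u * (m - u)) - (g u - g m) * (v - m)) by ring.
  eapply Rle_trans; [apply Rabs_triang|]. rewrite Rabs_Ropp, Rabs_mult.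
  assert (Hm : Rabs (g u - g m) * Rabs (v - m) <= 2 * K * ((m - u) * (v - m))).
  { rewrite <- (Rabs_pos_eq _ Hs), Rabs_mult, <- Rmult_assoc.
    apply Rmult_le_compat_r; [apply Rabs_pos | exact Hg]. }
  eapply Rle_trans; [apply Rplus_le_compat; [apply Rabs_triang | exact Hm]|].
  replace (K * (v - u) ^ 2) with
    (K * (v - m) ^ 2 + K * (m - u) ^ 2 + 2 * K * ((m - u) * (v - m))) by ring.
  lra.
Qed.

(* With [1 / transit a b u = 1 / u + 2 (1 / b - 1 / a)] on the left half of
   [0, a], extended by symmetry, [transit b c o transit a b = transit a c] and
   the derivative is 1 at both ends. *)
Definition transit_den a b u := 1 + 2 * (/ b - / a) * u.

Definition transit a b u :=
  if Rle_dec u (a / 2) then u / transit_den a b u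
  else b - (a - u) / transit_den a b (a - u).

Definition transit_deriv a b u :=
  if Rle_dec u (a / 2) then / transit_den a b u ^ 2
  else / transit_den a b (a - u) ^ 2.

(** On the left half the denominator interpolates linearly between 1 at 0 and [a / b] at [a / 2],
    and both values are at least [/ B]. *)
Lemma transit_den_ge a b B u : 0 < a -> 0 < b -> 1 <= B -> b <= B * a ->
  0 <= u <= a / 2 -> / B <= transit_den a b u.
Proof.
  intros Ha Hb HB Hba Hu. unfold transit_den.
  set (s := 2 * u / a).
  assert (Hs : 0 <= s <= 1).
  { unfold s. split; [apply Rdiv_le_0_compat; lra|].
    apply Rmult_le_reg_r with a; auto. unfold Rdiv. rewrite Rmult_assoc, Rinv_l; lra. }
  replace (1 + 2 * (/ b - / a) * u) with ((1 - s) * 1 + s * (a / b)) by (unfold s; field; lra).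
  assert (H1 : / B <= a / b).
  { apply Rmult_le_reg_r with (B * b); [nra|].
    replace (/ B * (B * b)) with b by (field; lra).
    replace (a / b * (B * b)) with (B * a) by (field; lra). lra. }
  assert (H2 : / B <= 1).
  { rewrite <- Rinv_1. apply Rinv_le_contravar; lra. }
  nra.
Qed.

Lemma transit_den_pos a b u : 0 < a -> 0 < b -> 0 <= u <= a / 2 -> 0 < transit_den a b u.
Proof.
  intros Ha Hb Hu.
  set (B := Rmax 1 (b / a)).
  assert (HB : 1 <= B) by apply Rmax_l.
  apply Rlt_le_trans with (/ B); [apply Rinv_0_lt_compat; lra|].
  apply transit_den_ge; auto.
  replace b with (b / a * a) at 1 by (field; lra).
  apply Rmult_le_compat_r; [lra | apply Rmax_r].
Qed.

Lemma transit_mirror a b u : 0 < a -> 0 < b ->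
  transit a b (a - u) = b - transit a b u.
Proof.
  intros Ha Hb. unfold transit.
  destruct (Rle_dec (a - u) (a / 2)), (Rle_dec u (a / 2)); try lra.
  - assert (u = a / 2) as -> by lra. replace (a - a / 2) with (a / 2) by lra.
    unfold transit_den. field. lra.
  - replace (a - (a - u)) with u by lra. reflexivity.
Qed.

Lemma transit_deriv_mirror a b u : transit_deriv a b (a - u) = transit_deriv a b u.
Proof.
  unfold transit_deriv. destruct (Rle_dec (a - u) (a / 2)), (Rle_dec u (a / 2)); try lra.
  - assert (u = a / 2) as -> by lra. replace (a - a / 2) with (a / 2) by lra. reflexivity.
  - replace (a - (a - u)) with u by lra. reflexivity.
Qed.

Lemma transit_half_range a b u : 0 < a -> 0 < b -> 0 <= u <= a / 2 ->
  0 <= u / transit_den a b u <= b / 2.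
Proof.
  intros Ha Hb Hu. pose proof (transit_den_pos a b u Ha Hb Hu) as Hd.
  split; [apply Rdiv_le_0_compat; lra|].
  apply Rmult_le_reg_r with (transit_den a b u); auto.
  replace (u / transit_den a b u * transit_den a b u) with u by (field; lra).
  unfold transit_den.
  replace (b / 2 * (1 + 2 * (/ b - / a) * u)) with (b / 2 + u - b * (u / a)) by (field; lra).
  assert (u / a <= 1 / 2); [|nra].
  apply Rmult_le_reg_r with a; auto. unfold Rdiv at 1. rewrite Rmult_assoc, Rinv_l; lra.
Qed.

Lemma transit_range a b u : 0 < a -> 0 < b -> 0 <= u <= a -> 0 <= transit a b u <= b.
Proof.
  intros Ha Hb Hu. unfold transit. destruct (Rle_dec u (a / 2)).
  - pose proof (transit_half_range a b u). lra.
  - pose proof (transit_half_range a b (a - u)). lra.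
Qed.

Lemma transit_half_comp a b c u : 0 < a -> 0 < b -> 0 < c -> 0 <= u <= a / 2 ->
  transit b c (transit a b u) = transit a c u.
Proof.
  intros Ha Hb Hc Hu. pose proof (transit_half_range a b u Ha Hb Hu) as Hr.
  pose proof (transit_den_pos a b u Ha Hb Hu) as Hd1.
  pose proof (transit_den_pos a c u Ha Hc Hu) as Hd2.
  unfold transit. destruct (Rle_dec u (a / 2)); [|lra].
  destruct (Rle_dec (u / transit_den a b u) (b / 2)); [|lra].
  pose proof (transit_den_pos b c (u / transit_den a b u) Hb Hc Hr) as Hd3.
  (* In the coordinate [1 / u] the half maps are translations, so denominators multiply along a
     composition. *)
  assert (E : transit_den b c (u / transit_den a b u) =
              transit_den a c u / transit_den a b u).
  { apply Rmult_eq_reg_r with (transit_den a b u); [|lra].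
    unfold Rdiv at 2. rewrite Rmult_assoc, Rinv_l, Rmult_1_r by lra.
    unfold transit_den at 1. rewrite Rmult_plus_distr_r.
    replace (2 * (/ c - / b) * (u / transit_den a b u) * transit_den a b u)
      with (2 * (/ c - / b) * u) by (field; lra).
    unfold transit_den. ring. }
  rewrite E. field. lra.
Qed.

Lemma transit_comp a b c u : 0 < a -> 0 < b -> 0 < c -> 0 <= u <= a ->
  transit b c (transit a b u) = transit a c u.
Proof.
  intros Ha Hb Hc Hu. destruct (Rle_dec u (a / 2)).
  - apply transit_half_comp; lra.
  - assert (Hv : 0 <= a - u <= a / 2) by lra.
    replace u with (a - (a - u)) by lra. set (v := a - u) in *.
    rewrite !transit_mirror, transit_half_comp by lra. reflexivity.
Qed.

Lemma transit_0 a b : 0 <= a -> transit a b 0 = 0.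
Proof.
  intros Ha. unfold transit. destruct (Rle_dec 0 (a / 2)); [|lra].
  unfold Rdiv. ring.
Qed.

Lemma transit_full a b : 0 < a -> 0 < b -> transit a b a = b.
Proof.
  intros Ha Hb. replace a with (a - 0) at 2 by lra.
  rewrite transit_mirror, transit_0; lra.
Qed.

Lemma transit_deriv_0 a b : 0 <= a -> transit_deriv a b 0 = 1.
Proof.
  intros Ha. unfold transit_deriv, transit_den. destruct (Rle_dec 0 (a / 2)); [|lra].
  rewrite Rmult_0_r, Rplus_0_r, pow1. apply Rinv_1.
Qed.

Lemma transit_deriv_full a b : 0 <= a -> transit_deriv a b a = 1.
Proof.
  intros Ha. replace a with (a - 0) at 2 by lra.
  rewrite transit_deriv_mirror. apply transit_deriv_0. exact Ha.
Qed.

Lemma transit_deriv_pos a b u : 0 < a -> 0 < b -> 0 <= u <= a -> 0 < transit_deriv a b u.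
Proof.
  intros Ha Hb Hu. unfold transit_deriv.
  destruct (Rle_dec u (a / 2)); apply Rinv_0_lt_compat, pow_lt, transit_den_pos; lra.
Qed.

Section TransitTaylor.

Variables a b B : R.
Hypotheses (Ha : 0 < a) (Hb : 0 < b) (HB : 1 <= B) (Hba : b <= B * a).

Let K := 2 * Rabs (/ b - / a) * B ^ 3.

Lemma transit_const_ge0 : 0 <= K.
Proof.
  unfold K. apply Rmult_le_pos; [|apply pow_le; lra].
  pose proof (Rabs_pos (/ b - / a)). lra.
Qed.

Lemma transit_taylor_left u v : 0 <= u <= a / 2 -> 0 <= v <= a / 2 ->
  taylor_error (transit a b) (transit_deriv a b) u v <= K * (v - u) ^ 2.
Proof.
  intros Hu Hv. unfold taylor_error, transit, transit_deriv.
  destruct (Rle_dec u (a / 2)); [|lra]. destruct (Rle_dec v (a / 2)); [|lra].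
  pose proof (transit_den_ge a b B u Ha Hb HB Hba Hu) as Hdu.
  pose proof (transit_den_ge a b B v Ha Hb HB Hba Hv) as Hdv.
  assert (HB' : 0 < / B) by (apply Rinv_0_lt_compat; lra).
  assert (Hinv : forall z, / B <= z -> 0 < / z <= B).
  { intros z Hz. split; [apply Rinv_0_lt_compat; lra|].
    rewrite <- (Rinv_inv B). apply Rinv_le_contravar; lra. }
  (* The remainder of the Moebius map u / (1 + k u) is exactly -k (v - u)^2 / ((1 + k u)^2 (1 + k
     v)). The three denominators account for [B ^ 3] in [K]. *)
  assert (E : v / transit_den a b v - u / transit_den a b u - / transit_den a b u ^ 2 * (v - u)
    = - (2 * (/ b - / a)) * ((/ transit_den a b u) ^ 2 * / transit_den a b v) * (v - u) ^ 2).
  { assert (Hk : transit_den a b v = transit_den a b u + 2 * (/ b - / a) * (v - u))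
      by (unfold transit_den; ring).
    assert (Hk0 : transit_den a b u = 1 + 2 * (/ b - / a) * u) by reflexivity.
    set (k := 2 * (/ b - / a)) in *.
    assert (E0 : v * transit_den a b u - u * transit_den a b v = v - u)
      by (rewrite Hk, Hk0; ring).
    assert (H1 : v / transit_den a b v - u / transit_den a b u
                 = (v - u) / (transit_den a b u * transit_den a b v)).
    { rewrite <- E0. field. split; lra. }
    rewrite H1, Hk. field. rewrite <- Hk. split; lra. }
  rewrite E, !Rabs_mult, Rabs_Ropp, Rabs_mult.
  rewrite (Rabs_pos_eq 2) by lra.
  rewrite (Rabs_pos_eq ((v - u) ^ 2)) by apply pow2_ge_0.
  apply Rmult_le_compat_r; [apply pow2_ge_0|]. unfold K.
  apply Rmult_le_compat_l; [pose proof (Rabs_pos (/ b - / a)); lra|].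
  pose proof (Hinv _ Hdu) as H1. pose proof (Hinv _ Hdv) as H2.
  rewrite (Rabs_pos_eq (_ ^ 2)) by apply pow2_ge_0.
  rewrite (Rabs_pos_eq (/ _)) by lra.
  replace (B ^ 3) with (B ^ 2 * B) by ring.
  apply Rmult_le_compat; [apply pow2_ge_0 | lra | apply pow_incr; lra | lra].
Qed.

Lemma transit_taylor_right u v : a / 2 <= u <= a -> a / 2 <= v <= a ->
  taylor_error (transit a b) (transit_deriv a b) u v <= K * (v - u) ^ 2.
Proof.
  intros Hu Hv. pose proof (transit_taylor_left (a - u) (a - v)) as H.
  unfold taylor_error in *. rewrite !transit_mirror, transit_deriv_mirror in H by auto.
  rewrite <- Rabs_Ropp.
  replace (- _) with (b - transit a b v - (b - transit a b u)
                      - transit_deriv a b u * (a - v - (a - u))) by ring.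
  replace ((v - u) ^ 2) with ((a - v - (a - u)) ^ 2) by ring. apply H; lra.
Qed.

Lemma transit_taylor u v : 0 <= u <= a -> 0 <= v <= a ->
  taylor_error (transit a b) (transit_deriv a b) u v <= K * (v - u) ^ 2.
Proof.
  intros Hu Hv. pose proof transit_const_ge0.
  destruct (Rle_lt_dec u (a / 2)), (Rle_lt_dec v (a / 2)).
  - apply transit_taylor_left; lra.
  - apply taylor_error_glue with (a / 2); auto.
    + apply Rmult_le_pos; lra.
    + apply transit_taylor_left; lra.
    + apply transit_taylor_left; lra.
    + apply transit_taylor_right; lra.
  - apply taylor_error_glue with (a / 2); auto.
    + nra.
    + apply transit_taylor_right; lra.
    + apply transit_taylor_right; lra.
    + apply transit_taylor_left; lra.
  - apply transit_taylor_right; lra.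
Qed.

End TransitTaylor.

(** The power d^(1 + tau), written as a product so that it vanishes at [d = 0], where [Rpower] does
    not. *)
Definition hpow tau d := d * Rpower d tau.

Lemma Rpower_pos x y : 0 < Rpower x y.
Proof. apply exp_pos. Qed.

Lemma hpow_ge0 tau d : 0 <= d -> 0 <= hpow tau d.
Proof. intros H. pose proof (Rpower_pos d tau). unfold hpow. nra. Qed.

Lemma hpow_mono tau x y : 0 <= tau -> 0 <= x <= y -> hpow tau x <= hpow tau y.
Proof.
  intros Ht [[H| <-] Hxy].
  - unfold hpow. apply Rmult_le_compat; try lra; [left; apply Rpower_pos|].
    apply Rle_Rpower_l; lra.
  - unfold hpow at 1. rewrite Rmult_0_l. apply hpow_ge0, Hxy.
Qed.

(** Since d^(1 - tau) <= a^(1 - tau), a quadratic error with constant a^(tau - 1) on a gap of length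
    [a] becomes a Hoelder error whose constant does not depend on the gap. *)
Lemma square_le_hpow tau a d : tau <= 1 -> 0 < a -> 0 <= d <= a ->
  Rpower a tau / a * d ^ 2 <= hpow tau d.
Proof.
  intros Ht Ha [[Hd| <-] Hda]; [|unfold hpow; lra].
  assert (E : forall z, 0 < z -> Rpower z tau = z / Rpower z (1 - tau)).
  { intros z Hz. replace tau with (1 + - (1 - tau)) at 1 by lra.
    rewrite Rpower_plus, Rpower_1, Rpower_Ropp by auto. reflexivity. }
  unfold hpow. rewrite !E by auto.
  assert (H : Rpower d (1 - tau) <= Rpower a (1 - tau)) by (apply Rle_Rpower_l; lra).
  pose proof (Rpower_pos d (1 - tau)). pose proof (Rpower_pos a (1 - tau)).
  replace (a / Rpower a (1 - tau) / a * d ^ 2) with (d ^ 2 * / Rpower a (1 - tau))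
    by (field; lra).
  replace (d * (d / Rpower d (1 - tau))) with (d ^ 2 * / Rpower d (1 - tau)) by (field; lra).
  apply Rmult_le_compat_l; [apply pow2_ge_0|]. apply Rinv_le_contravar; lra.
Qed.

(** * From uniform Taylor estimates to Hoelder derivatives *)

Section HolderTaylor.

Variables (f g : R -> R) (tau C : R).
Hypotheses (Htau : 0 < tau) (HC : 0 <= C).

Let T x y := taylor_error f g x y <= C * hpow tau (Rabs (y - x)).

Lemma taylor_holder x y : x <> y -> T x y -> T y x ->
  Rabs (g x - g y) <= 2 * C * Rpower (Rabs (x - y)) tau.
Proof.
  unfold T. rewrite (Rabs_minus_sym x y). intros Hne H1 H2.
  assert (0 < Rabs (y - x)) by (apply Rabs_pos_lt; lra).
  apply Rmult_le_reg_r with (Rabs (y - x)); auto.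
  pose proof (taylor_error_deriv f g x y _ H1 H2). unfold hpow in *. lra.
Qed.

Lemma taylor_is_derive x : (forall y, T x y) -> is_derive f x (g x).
Proof.
  intros H. apply is_derive_Reals. intros eps Heps.
  (* The radius eta^(1 / tau) makes |h|^tau < eta; the [+ 1] covers [C = 0] and gives the strict
     inequality. *)
  set (eta := eps / (C + 1)).
  assert (Heta : 0 < eta) by (apply Rdiv_lt_0_compat; lra).
  exists (mkposreal _ (Rpower_pos eta (/ tau))). simpl. intros h Hh Hd.
  specialize (H (x + h)). unfold T, taylor_error, hpow in H.
  replace (x + h - x) with h in H by ring.
  assert (Hp : 0 < Rabs h) by (apply Rabs_pos_lt; auto).
  assert (Hr : Rpower (Rabs h) tau < eta).
  { replace eta with (Rpower (Rpower eta (/ tau)) tau).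
    - apply Rlt_Rpower_l; lra.
    - rewrite Rpower_mult, Rinv_l, Rpower_1 by lra. reflexivity. }
  replace ((f (x + h) - f x) / h - g x) with ((f (x + h) - f x - g x * h) / h)
    by (field; auto).
  unfold Rdiv at 1. rewrite Rabs_mult, Rabs_inv.
  apply Rmult_lt_reg_r with (Rabs h); auto. rewrite Rmult_assoc, Rinv_l, Rmult_1_r by lra.
  eapply Rle_lt_trans; [exact H|].
  replace eps with (C * eta + eta) by (unfold eta; field; lra).
  assert (0 <= C * Rabs h) by (apply Rmult_le_pos; lra). nra.
Qed.

(* [x] and [y] lie in different gaps, whose facing ends are [e1] and [e2]. *)
Lemma taylor_chain x e1 e2 y : x <= e1 -> e1 < e2 -> e2 <= y -> g e1 = 1 -> g e2 = 1 ->
  T x e1 -> T e1 x -> T e1 e2 -> T e2 y -> T y e2 ->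
  taylor_error f g x y <= 5 * C * hpow tau (Rabs (y - x)) /\
  taylor_error f g y x <= 5 * C * hpow tau (Rabs (y - x)).
Proof.
  intros L1 L2 L3 G1 G2 T1 T1' T2 T3 T3'.
  set (d := y - x). rewrite (Rabs_pos_eq d) by (unfold d; lra).
  assert (Hd : 0 < d) by (unfold d; lra).
  assert (Hm : forall z, Rabs z <= d -> C * hpow tau (Rabs z) <= C * hpow tau d).
  { intros z Hz. apply Rmult_le_compat_l; auto. apply hpow_mono; [lra|].
    split; [apply Rabs_pos | auto]. }
  assert (M : C * hpow tau d = C * Rpower d tau * d) by (unfold hpow; ring).
  assert (Hg : forall p q, Rabs (p - q) <= d -> g q = 1 -> T p q -> T q p ->
    Rabs ((g p - 1) * d) <= 2 * (C * hpow tau d)).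
  { intros p q Hpq Hq H1 H2. destruct (Req_dec p q) as [->|Hne].
    - rewrite Hq, Rminus_diag, Rmult_0_l, Rabs_R0.
      pose proof (hpow_ge0 tau d (Rlt_le _ _ Hd)). nra.
    - pose proof (taylor_holder p q Hne H1 H2) as Hh. rewrite Hq in Hh.
      rewrite Rabs_mult, (Rabs_pos_eq d), M, <- !Rmult_assoc by lra.
      apply Rmult_le_compat_r; [lra|].
      eapply Rle_trans; [exact Hh|]. apply Rmult_le_compat_l; [lra|].
      apply Rle_Rpower_l; [lra|]. split; [apply Rabs_pos_lt; lra | auto]. }
  assert (Hx : Rabs ((g x - 1) * d) <= 2 * (C * hpow tau d)).
  { apply Hg with e1; auto. apply Rabs_le. unfold d. lra. }
  assert (Hy : Rabs ((g y - 1) * d) <= 2 * (C * hpow tau d)).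
  { apply Hg with e2; auto. apply Rabs_le. unfold d. lra. }
  (* Origin of the 5: each of the three legs is compared with slope 1, for 3 in all, and replacing 1
     by [g x] or [g y] costs 2 more. *)
  assert (E : Rabs (f y - f x - (y - x)) <= 3 * (C * hpow tau d)).
  { unfold T, taylor_error in *. rewrite G1 in *. rewrite G2 in *.
    assert (A1 : Rabs (f x - f e1 - 1 * (x - e1)) <= C * hpow tau d).
    { eapply Rle_trans; [exact T1'|]. apply Hm. apply Rabs_le. unfold d. lra. }
    assert (A2 : Rabs (f e2 - f e1 - 1 * (e2 - e1)) <= C * hpow tau d).
    { eapply Rle_trans; [exact T2|]. apply Hm. apply Rabs_le. unfold d. lra. }
    assert (A3 : Rabs (f y - f e2 - 1 * (y - e2)) <= C * hpow tau d).
    { eapply Rle_trans; [exact T3|]. apply Hm. apply Rabs_le. unfold d. lra. }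
    apply Rabs_le_between in A1, A2, A3. apply Rabs_le. lra. }
  apply Rabs_le_between in Hx, Hy, E. unfold taylor_error, d in *.
  split; apply Rabs_le; lra.
Qed.

End HolderTaylor.

(** * Blowing up the atoms of a periodic weight *)

Section Blowup.

Variable w : R -> R.
Hypothesis w_ge0 : forall t, 0 <= w t.
Hypothesis w_succ : forall t, w (t + 1) = w t.
Hypothesis w_total : forall L, NoDup L -> (forall p, In p L -> 0 <= p < 1) -> lsum w L <= 1 / 2.

Lemma periodic_IZR (n : Z) t : w (t + IZR n) = w t.
Proof.
  rewrite (quasiperiodic_IZR w 0); [ring|]. intros z. rewrite w_succ. ring.
Qed.

Lemma lsum_unit a L : NoDup L -> (forall p, In p L -> a <= p < a + 1) -> lsum w L <= 1 / 2.
Proof.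
  intros HL Ha.
  replace (lsum w L) with (lsum w (map frac_part L)).
  - apply w_total.
    + apply NoDup_map_NoDup_ForallPairs; auto. intros x y Hx Hy E.
      apply frac_part_eq; auto. apply Ha in Hx, Hy. lra.
    + intros p Hp. apply in_map_iff in Hp. destruct Hp as (q & <- & _).
      destruct (base_fp q). lra.
  - clear HL Ha. induction L as [|b L IH]; simpl; [reflexivity|]. rewrite IH. f_equal.
    unfold frac_part, Rminus. rewrite <- opp_IZR. apply periodic_IZR.
Qed.

Lemma summable_co a b : summable w (fun p => a <= p < b).
Proof.
  assert (H : forall n : nat, summable w (fun p => a <= p < a + INR n)).
  { induction n as [|n IH].
    - exists 0. intros [|p L] _ H; simpl; [lra|].
      specialize (H p (or_introl eq_refl)). simpl in H. lra.
    - apply summable_sub with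
        (fun p => a <= p < a + INR n \/ a + INR n <= p < a + INR n + 1).
      + intros p. rewrite S_INR. intros Hp.
        destruct (Rlt_le_dec p (a + INR n)); [left|right]; lra.
      + apply summable_union; auto. exists (1 / 2). apply lsum_unit. }
  destruct (nfloor_ex (Rmax 0 (b - a)) (Rmax_l _ _)) as (n & _ & Hn).
  apply summable_sub with (2 := H (S n)). intros p Hp. rewrite S_INR.
  pose proof (Rmax_r 0 (b - a)). lra.
Qed.

Lemma summable_oo a b : summable w (fun p => a < p < b).
Proof. apply summable_sub with (2 := summable_co a b). intros p. lra. Qed.

(** Half-open intervals add up without overlap; the open ones measure what lies strictly between two
    blown-up points. *)
Definition mass_co s t := mass w (fun p => s <= p < t).
Definition mass_oo s t := mass w (fun p => s < p < t).

Lemma mass_co_chasles s t u : s <= t <= u -> mass_co s u = mass_co s t + mass_co t u.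
Proof.
  intros H. apply mass_union; [apply summable_co| |]; intros p; [|lra].
  split; [|lra]. intros Hp. destruct (Rlt_le_dec p t); [left|right]; lra.
Qed.

Lemma mass_co_oo s t : s < t -> mass_co s t = w s + mass_oo s t.
Proof.
  intros H. rewrite <- (mass_singleton w s) by auto.
  apply mass_union; [apply summable_co| |]; intros p; [|lra].
  split; [|lra]. intros Hp. destruct (Req_dec p s); [left|right]; lra.
Qed.

Lemma mass_oo_ge0 s t : 0 <= mass_oo s t.
Proof. apply mass_ge0, summable_oo. Qed.

Lemma mass_co_shift (n : Z) s t : mass_co (s + IZR n) (t + IZR n) = mass_co s t.
Proof.
  unfold mass_co. rewrite <- (mass_translate w _ (IZR n)).
  apply mass_ext; intros p; [apply periodic_IZR | split; lra].
Qed.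

Lemma mass_oo_translate r s t :
  mass_oo (s + r) (t + r) = mass (fun p => w (p + r)) (fun p => s < p < t).
Proof.
  unfold mass_oo. rewrite <- (mass_translate w _ r).
  apply mass_ext; intros p; [reflexivity | split; lra].
Qed.

Lemma mass_co_refl t : mass_co t t = 0.
Proof. pose proof (mass_co_chasles t t t). lra. Qed.

Lemma mass_co_unit t : mass_co t (t + 1) = mass_co 0 1.
Proof.
  destruct (base_Int_part t) as [H1 H2]. set (n := IZR (Int_part t)) in *.
  rewrite (mass_co_chasles t (n + 1) (t + 1)) by lra.
  rewrite (mass_co_shift 1). rewrite Rplus_comm, <- mass_co_chasles by lra.
  rewrite <- (mass_co_shift (Int_part t) 0 1). f_equal; unfold n; lra.
Qed.

Definition cumul t := if Rle_dec 0 t then mass_co 0 t else - mass_co t 0.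

Lemma cumul_diff s t : s <= t -> cumul t - cumul s = mass_co s t.
Proof.
  intros H. unfold cumul.
  destruct (Rle_dec 0 t), (Rle_dec 0 s); try lra.
  - rewrite (mass_co_chasles 0 s t) by lra. lra.
  - rewrite (mass_co_chasles s 0 t) by lra. lra.
  - rewrite (mass_co_chasles s t 0) by lra. lra.
Qed.

(** The density of the Lebesgue part for which, atoms included, every unit interval has total
    measure 1; the blown-up line then has period 1 again. *)
Definition slope := 1 - mass_co 0 1.

Lemma slope_ge : 1 / 2 <= slope.
Proof.
  unfold slope. assert (mass_co 0 1 <= 1 / 2); [|lra]. apply mass_least, w_total.
Qed.

(* [jump t] is the left end of the (possibly degenerate) interval of length
   [w t] which replaces the point [t]. *)
Definition jump t := slope * t + cumul t.

Lemma jump_succ t : jump (t + 1) = jump t + 1.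
Proof.
  pose proof (cumul_diff t (t + 1)) as H. rewrite mass_co_unit in H.
  unfold jump. assert (cumul (t + 1) - cumul t = mass_co 0 1) by (apply H; lra).
  unfold slope in *. lra.
Qed.

Lemma jump_diff s t : s < t -> jump t - (jump s + w s) = slope * (t - s) + mass_oo s t.
Proof.
  intros H. pose proof (cumul_diff s t). rewrite mass_co_oo in H0 by lra.
  unfold jump. lra.
Qed.

Lemma jump_lt s t : s < t -> jump s + w s < jump t.
Proof.
  intros H. pose proof (jump_diff s t H). pose proof (mass_oo_ge0 s t).
  pose proof slope_ge. nra.
Qed.

Lemma jump_mono s t : s <= t -> jump s <= jump t.
Proof.
  intros [H| ->]; [|lra]. pose proof (jump_lt s t H). pose proof (w_ge0 s). lra.
Qed.

Lemma jump_0 : jump 0 = 0.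
Proof.
  unfold jump, cumul. destruct (Rle_dec 0 0); [|lra]. rewrite mass_co_refl. lra.
Qed.

Lemma jump_IZR (n : Z) t : jump (t + IZR n) = jump t + IZR n.
Proof.
  rewrite (quasiperiodic_IZR jump 1); [ring|]. apply jump_succ.
Qed.

Lemma jump_dist t : Rabs (jump t - t) <= 1.
Proof.
  destruct (base_Int_part t) as [H1 H2]. set (n := Int_part t) in *.
  pose proof (jump_mono (IZR n) t). pose proof (jump_mono t (IZR n + 1)).
  rewrite jump_succ in H0.
  pose proof (jump_IZR n 0) as E. rewrite Rplus_0_l, jump_0 in E.
  apply Rabs_le. lra.
Qed.

Lemma w_le_half t : w t <= 1 / 2.
Proof.
  rewrite <- (mass_singleton w t) by auto. apply mass_least. intros L HL Ht.
  apply lsum_unit with t; auto. intros p Hp. rewrite (Ht p Hp). lra.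
Qed.

(** Finitely many atoms carry all but eps/2 of the mass of [t - 1, t). A point [s] beyond all of
    them and close to [t] leaves at most eps/2 of atoms and eps/2 of Lebesgue measure. *)
Lemma jump_left_limit t eps : 0 < eps -> exists s, s < t /\ jump t - jump s < eps.
Proof.
  intros He.
  destruct (mass_approx w (fun p => t - 1 <= p < t) (eps / 2)) as (L & HL & Hin & Hap).
  { apply summable_co. } { lra. }
  assert (Hs : exists s, t - 1 <= s < t /\ forall p, In p L -> p < s).
  { clear - Hin. induction L as [|a L IH].
    - exists (t - 1). split; [lra|]. intros p [].
    - destruct IH as (s & Hs & H). { intros p Hp. apply Hin. right. exact Hp. }
      specialize (Hin a (or_introl eq_refl)).
      exists (Rmax s ((a + t) / 2)). split.
      + split; [eapply Rle_trans; [apply Hs | apply Rmax_l] | apply Rmax_lub_lt; lra].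
      + intros p [<-|Hp].
        * apply Rlt_le_trans with (2 := Rmax_r _ _). lra.
        * apply Rlt_le_trans with (2 := Rmax_l _ _). auto. }
  destruct Hs as (s & Hs & HLs). pose proof slope_ge.
  set (s' := Rmax s (t - eps / 2 / slope)).
  assert (Hd : 0 < eps / 2 / slope) by (apply Rdiv_lt_0_compat; lra).
  assert (Hs' : s' < t) by (apply Rmax_lub_lt; lra).
  assert (s <= s') by apply Rmax_l.
  assert (Hs2 : t - eps / 2 / slope <= s') by apply Rmax_r.
  exists s'. split; auto.
  pose proof (cumul_diff s' t (Rlt_le _ _ Hs')) as Hc. unfold jump.
  assert (H1 : mass_co (t - 1) t = mass_co (t - 1) s' + mass_co s' t)
    by (apply mass_co_chasles; lra).
  assert (H2 : lsum w L <= mass_co (t - 1) s').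
  { apply mass_ub; auto. apply summable_co. intros p Hp.
    pose proof (HLs p Hp). pose proof (Hin p Hp). simpl in *. lra. }
  unfold mass_co in H1 at 1.
  assert (slope * (t - s') <= eps / 2).
  { replace (eps / 2) with (slope * (eps / 2 / slope)) by (field; lra).
    apply Rmult_le_compat_l; lra. }
  lra.
Qed.

(** The mirror argument; the atom at [t] itself belongs to [t, s) for every s > t and accounts for
    the jump [w t]. *)
Lemma jump_right_limit t eps : 0 < eps -> exists s, t < s /\ jump s - (jump t + w t) < eps.
Proof.
  intros He.
  destruct (mass_approx w (fun p => t < p < t + 1) (eps / 2)) as (L & HL & Hin & Hap).
  { apply summable_oo. } { lra. }
  assert (Hs : exists s, t < s <= t + 1 /\ forall p, In p L -> s <= p).
  { clear - Hin. induction L as [|a L IH].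
    - exists (t + 1). split; [lra|]. intros p [].
    - destruct IH as (s & Hs & H). { intros p Hp. apply Hin. right. exact Hp. }
      specialize (Hin a (or_introl eq_refl)).
      exists (Rmin s a). split.
      + split; [apply Rmin_glb_lt; lra | eapply Rle_trans; [apply Rmin_l | lra]].
      + intros p [<-|Hp].
        * apply Rmin_r.
        * apply Rle_trans with (1 := Rmin_l _ _). auto. }
  destruct Hs as (s & Hs & HLs). pose proof slope_ge.
  set (s' := Rmin s (t + eps / 2 / slope)).
  assert (Hd : 0 < eps / 2 / slope) by (apply Rdiv_lt_0_compat; lra).
  assert (Hs' : t < s') by (apply Rmin_glb_lt; lra).
  assert (s' <= s) by apply Rmin_l.
  assert (Hs2 : s' <= t + eps / 2 / slope) by apply Rmin_r.
  exists s'. split; auto.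
  rewrite jump_diff by auto.
  assert (H1 : mass_oo t (t + 1) = mass_oo t s' + mass_co s' (t + 1)).
  { pose proof (mass_co_chasles t s' (t + 1)).
    rewrite !(mass_co_oo t) in H1 by lra. lra. }
  assert (H2 : lsum w L <= mass_co s' (t + 1)).
  { apply mass_ub; auto. apply summable_co. intros p Hp.
    pose proof (HLs p Hp). pose proof (Hin p Hp). simpl in *. lra. }
  unfold mass_oo in H1 at 1.
  assert (slope * (s' - t) <= eps / 2).
  { replace (eps / 2) with (slope * (eps / 2 / slope)) by (field; lra).
    apply Rmult_le_compat_l; lra. }
  lra.
Qed.

(** * Gaps, degenerate ones included, and the collapse map *)

Definition in_gap t x := jump t <= x <= jump t + w t.

(** Take the supremum [t] of the points with [jump] at most [x]. The one-sided limits of [jump] at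
    [t] are the two ends of the gap, so [x] cannot lie outside it. *)
Lemma in_gap_ex x : exists t, in_gap t x.
Proof.
  destruct (completeness (fun t => jump t <= x)) as [t [Hub Hleast]].
  - exists (x + 1). intros t Ht. pose proof (jump_dist t) as H.
    apply Rabs_le_between in H. lra.
  - exists (x - 1). pose proof (jump_dist (x - 1)) as H. apply Rabs_le_between in H. lra.
  - exists t. split.
    + apply Rnot_lt_le. intros H.
      destruct (jump_left_limit t (jump t - x)) as (s & Hs & Hj); [lra|].
      assert (t <= s); [|lra]. apply Hleast. intros u Hu.
      apply Rnot_lt_le. intros Hsu. pose proof (jump_mono s u). lra.
    + apply Rnot_lt_le. intros H.
      destruct (jump_right_limit t (x - (jump t + w t))) as (s & Hs & Hj); [lra|].
      assert (s <= t); [|lra]. apply Hub. lra.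
Qed.

(** The Denjoy semiconjugacy onto the translations. Closed gaps over distinct points are disjoint,
    so the choice is forced. *)
Definition collapse x := epsilon (inhabits 0) (fun t => in_gap t x).

Lemma collapse_spec x : in_gap (collapse x) x.
Proof. unfold collapse. apply epsilon_spec, in_gap_ex. Qed.

Lemma collapse_unique t x : in_gap t x -> collapse x = t.
Proof.
  intros H. pose proof (collapse_spec x) as H'. unfold in_gap in *.
  destruct (Rtotal_order (collapse x) t) as [Hl|[E|Hl]]; auto;
    apply jump_lt in Hl; lra.
Qed.

Lemma collapse_succ x : collapse (x + 1) = collapse x + 1.
Proof.
  apply collapse_unique. pose proof (collapse_spec x). unfold in_gap in *.
  rewrite jump_succ, w_succ. lra.
Qed.

Lemma collapse_dist x : Rabs (collapse x - x) <= 2.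
Proof.
  pose proof (collapse_spec x) as H. pose proof (jump_dist (collapse x)) as H'.
  pose proof (w_le_half (collapse x)). unfold in_gap in *.
  apply Rabs_le_between in H'. apply Rabs_le. lra.
Qed.


(* In the coordinates [x = (t, u)], [t = collapse x], [u = x - jump t], this is
   [(t, u) |-> (t + r, transit (w t) (w (t + r)) u)]; when [w t = w (t + r) = 0] the
   division by 0 in [transit] is harmless since then [u = 0]. *)
Definition lift r x :=
  jump (collapse x + r)
  + transit (w (collapse x)) (w (collapse x + r)) (x - jump (collapse x)).

Definition lift_deriv r x :=
  transit_deriv (w (collapse x)) (w (collapse x + r)) (x - jump (collapse x)).

(** Translation by [r] preserves the set of atoms, so nondegenerate gaps go to nondegenerate
    gaps. *)
Definition invariant r := forall t, 0 < w t <-> 0 < w (t + r).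

Lemma invariant_zero r t : invariant r -> w t = 0 -> w (t + r) = 0.
Proof.
  intros Hr H. destruct (w_ge0 (t + r)) as [H'|H']; [|lra]. apply Hr in H'. lra.
Qed.

Lemma lift_eq r t x : in_gap t x ->
  lift r x = jump (t + r) + transit (w t) (w (t + r)) (x - jump t).
Proof. intros H. unfold lift. rewrite (collapse_unique t x H). reflexivity. Qed.

Lemma lift_deriv_eq r t x : in_gap t x ->
  lift_deriv r x = transit_deriv (w t) (w (t + r)) (x - jump t).
Proof. intros H. unfold lift_deriv. rewrite (collapse_unique t x H). reflexivity. Qed.

Lemma in_gap_zero t x : in_gap t x -> w t = 0 -> x = jump t.
Proof. unfold in_gap. lra. Qed.

Lemma in_gap_lift r t x : invariant r -> in_gap t x -> in_gap (t + r) (lift r x).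
Proof.
  intros Hr H. rewrite (lift_eq r t x H). unfold in_gap in *.
  destruct (w_ge0 t) as [Hw|Hw].
  - pose proof (transit_range (w t) (w (t + r)) (x - jump t) Hw (proj1 (Hr t) Hw)). lra.
  - rewrite (in_gap_zero t x H), Rminus_diag, transit_0 by (auto; lra).
    pose proof (w_ge0 (t + r)). lra.
Qed.

Lemma collapse_lift r x : invariant r -> collapse (lift r x) = collapse x + r.
Proof. intros Hr. apply collapse_unique, in_gap_lift; auto. apply collapse_spec. Qed.

(** On a nondegenerate gap this is the composition law [transit_comp]; on a degenerate one every
    [transit] is evaluated at 0 and gives 0. *)
Lemma lift_lift r s x : invariant r -> invariant s ->
  lift r (lift s x) = lift (s + r) x.
Proof.
  intros Hr Hs. pose proof (collapse_spec x) as H. set (t := collapse x) in *.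
  rewrite (lift_eq r (t + s)) by (apply in_gap_lift; auto).
  rewrite (lift_eq s t x H), (lift_eq (s + r) t x H).
  rewrite <- Rplus_assoc. f_equal.
  replace (jump (t + s) + _ - jump (t + s))
    with (transit (w t) (w (t + s)) (x - jump t)) by ring.
  destruct (w_ge0 t) as [Hw|Hw].
  - unfold in_gap in H. pose proof (proj1 (Hs t) Hw) as Hw'.
    apply transit_comp; auto; [apply (Hr (t + s)); auto | lra].
  - pose proof (invariant_zero s t Hs (eq_sym Hw)) as Hw'.
    rewrite (in_gap_zero t x H) by auto. rewrite Rminus_diag, <- Hw, Hw', !transit_0; lra.
Qed.

Lemma lift_succ r x : lift r (x + 1) = lift r x + 1.
Proof.
  unfold lift. rewrite collapse_succ, jump_succ, w_succ.
  replace (collapse x + 1 + r) with (collapse x + r + 1) by ring.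
  rewrite jump_succ, w_succ.
  replace (x + 1 - (jump (collapse x) + 1)) with (x - jump (collapse x)) by ring.
  ring.
Qed.

Lemma lift_deriv_pos r x : invariant r -> 0 < lift_deriv r x.
Proof.
  intros Hr. unfold lift_deriv. generalize (collapse_spec x).
  generalize (collapse x). intros t H. destruct (w_ge0 t) as [Hw|Hw].
  - unfold in_gap in H. apply transit_deriv_pos; [auto | exact (proj1 (Hr t) Hw) | lra].
  - rewrite (in_gap_zero t x H), Rminus_diag, transit_deriv_0 by auto; lra.
Qed.

Lemma collapse_iter_lift r n x : invariant r ->
  collapse (Nat.iter n (lift r) x) = collapse x + INR n * r.
Proof.
  intros Hr. induction n as [|n IH].
  - simpl. ring.
  - rewrite Nat.iter_succ, collapse_lift, IH, S_INR by auto. ring.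
Qed.

(** [collapse] turns the n-th iterate into translation by n r and is within 2 of the identity; the
    displacement therefore differs from n r by at most 4, 2 for each end. *)
Lemma lift_rotation_number r : invariant r -> has_rotation_number (lift r) r.
Proof.
  intros Hr. exists r. split; [exists 0%Z; simpl; ring|]. intros x.
  assert (H4 : forall n, Rabs (Nat.iter n (lift r) x - x - INR n * r) <= 4).
  { intros n. pose proof (collapse_iter_lift r n x Hr) as E.
    pose proof (collapse_dist x) as H1.
    pose proof (collapse_dist (Nat.iter n (lift r) x)) as H2.
    apply Rabs_le_between in H1, H2. apply Rabs_le. lra. }
  assert (Hlim : forall c, is_lim_seq (fun n => r + c / INR n) r).
  { intros c. replace (Finite r) with (Finite (r + c * 0)) by (f_equal; ring).
    apply is_lim_seq_plus'; [apply is_lim_seq_const|].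
    apply is_lim_seq_mult'; [apply is_lim_seq_const|].
    replace (Finite 0) with (Rbar_inv p_infty) by reflexivity.
    apply is_lim_seq_inv; [apply is_lim_seq_INR | discriminate]. }
  refine (is_lim_seq_le_le_loc _ _ _ _ _ (Hlim (-4)) (Hlim 4)).
  exists 1%nat. intros n Hn.
  assert (Hp : 0 < INR n) by (apply lt_0_INR; lia).
  specialize (H4 n). apply Rabs_le_between in H4.
  split; apply Rmult_le_reg_r with (INR n); auto;
    unfold Rdiv; rewrite Rmult_plus_distr_r, !Rmult_assoc, Rinv_l; lra.
Qed.

(** * Regularity of the lifts *)

Section LiftRegularity.

Variables r tau B C : R.
Hypothesis Htau : 0 < tau < 1.
Hypotheses (HB : 1 <= B) (HC : 0 <= C).
Hypothesis w_ratio : forall t, w t <= B * w (t + r) /\ w (t + r) <= B * w t.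
Hypothesis w_holder : forall t, Rabs (w (t + r) - w t) <= C * hpow tau (w t).

Lemma ratio_invariant : invariant r.
Proof.
  intros t. pose proof (w_ratio t). pose proof (w_ge0 t). pose proof (w_ge0 (t + r)).
  split; intros; nra.
Qed.

(** With a = w t and b = w (t + r), the hypotheses give |1/b - 1/a| <= C B a^(tau - 1); the
    remaining factor 2 B^3 is that of [transit_taylor]. *)
Let K := 2 * C * B ^ 4.

Lemma C_le_K : C <= K.
Proof. unfold K. assert (1 <= B ^ 4) by (apply pow_R1_Rle; auto). nra. Qed.

Lemma lift_taylor_gap t x y : in_gap t x -> in_gap t y ->
  taylor_error (lift r) (lift_deriv r) x y <= K * hpow tau (Rabs (y - x)).
Proof.
  intros Hx Hy. unfold taylor_error.
  rewrite (lift_eq r t x Hx), (lift_eq r t y Hy), (lift_deriv_eq r t x Hx).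
  pose proof C_le_K.
  destruct (w_ge0 t) as [Hw|Hw].
  - pose proof (proj1 (ratio_invariant t) Hw) as Hw'.
    destruct (w_ratio t) as [R1 R2]. pose proof (w_holder t) as HH.
    set (a := w t) in *. set (b := w (t + r)) in *. unfold in_gap in *. fold a in Hx, Hy.
    set (u := x - jump t). set (v := y - jump t).
    assert (Hd : Rabs (y - x) <= a) by (apply Rabs_le; lra).
    pose proof (transit_taylor a b B Hw Hw' HB R2 u v) as HT. unfold taylor_error in HT.
    replace (jump (t + r) + transit a b v - (jump (t + r) + transit a b u)
             - transit_deriv a b u * (y - x))
      with (transit a b v - transit a b u - transit_deriv a b u * (v - u))
      by (unfold u, v; ring).
    eapply Rle_trans; [apply HT; unfold u, v; lra|].
    replace ((v - u) ^ 2) with (Rabs (y - x) ^ 2)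
      by (rewrite pow2_abs; unfold u, v; ring).
    assert (Hk : Rabs (/ b - / a) <= C * B * (Rpower a tau / a)).
    { replace (/ b - / a) with ((b - a) * (- (/ b * / a))) by (field; lra).
      rewrite Rabs_mult, Rabs_Ropp.
      assert (Hia : 0 < / a) by (apply Rinv_0_lt_compat; lra).
      assert (Hib : 0 < / b) by (apply Rinv_0_lt_compat; lra).
      rewrite (Rabs_pos_eq (/ b * / a)) by nra.
      apply Rle_trans with (C * hpow tau a * (/ b * / a)).
      { apply Rmult_le_compat_r; [nra | exact HH]. }
      assert (Hib' : / b <= B * / a).
      { apply Rmult_le_reg_r with (a * b); [nra|].
        replace (/ b * (a * b)) with a by (field; lra).
        replace (B * / a * (a * b)) with (B * b) by (field; lra). exact R1. }
      unfold hpow. pose proof (Rpower_pos a tau).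
      replace (C * (a * Rpower a tau) * (/ b * / a)) with (C * Rpower a tau * / b)
        by (field; lra).
      replace (C * B * (Rpower a tau / a)) with (C * Rpower a tau * (B * / a))
        by (field; lra).
      apply Rmult_le_compat_l; nra. }
    pose proof (square_le_hpow tau a (Rabs (y - x))) as Hsq.
    assert (Hs : Rpower a tau / a * Rabs (y - x) ^ 2 <= hpow tau (Rabs (y - x))).
    { apply Hsq; [lra | auto | split; [apply Rabs_pos | auto]]. }
    apply Rle_trans with (2 * (C * B * (Rpower a tau / a)) * B ^ 3 * Rabs (y - x) ^ 2).
    + apply Rmult_le_compat_r; [apply pow2_ge_0|].
      apply Rmult_le_compat_r; [apply pow_le; lra|]. lra.
    + replace (2 * (C * B * (Rpower a tau / a)) * B ^ 3 * Rabs (y - x) ^ 2)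
        with (K * (Rpower a tau / a * Rabs (y - x) ^ 2)) by (unfold K; ring).
      apply Rmult_le_compat_l; lra.
  - rewrite (in_gap_zero t x Hx), (in_gap_zero t y Hy) by auto.
    rewrite !Rminus_diag, Rmult_0_r, Rminus_diag, Rabs_R0. unfold hpow. lra.
Qed.

Lemma lift_left t : lift r (jump t) = jump (t + r) /\ lift_deriv r (jump t) = 1.
Proof.
  assert (H : in_gap t (jump t)) by (unfold in_gap; pose proof (w_ge0 t); lra).
  rewrite (lift_eq r t), (lift_deriv_eq r t), Rminus_diag, transit_0, transit_deriv_0 by auto.
  split; ring.
Qed.

Lemma lift_right t : lift r (jump t + w t) = jump (t + r) + w (t + r) /\
  lift_deriv r (jump t + w t) = 1.
Proof.
  assert (H : in_gap t (jump t + w t)) by (unfold in_gap; pose proof (w_ge0 t); lra).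
  rewrite (lift_eq r t), (lift_deriv_eq r t) by auto.
  replace (jump t + w t - jump t) with (w t) by ring.
  rewrite transit_deriv_full by auto. split; [|reflexivity]. f_equal.
  destruct (w_ge0 t) as [Hw|Hw].
  - apply transit_full; auto. exact (proj1 (ratio_invariant t) Hw).
  - rewrite (invariant_zero r t ratio_invariant (eq_sym Hw)), <- Hw, transit_0; lra.
Qed.

(** The Lebesgue parts cancel, so the error is a difference of atomic masses. Each atom between the
    two gaps has size at most the distance d, hence changes by at most C d^tau times itself; summing
    gives C d^tau times a mass bounded by d. *)
Lemma lift_taylor_across s t : s < t ->
  taylor_error (lift r) (lift_deriv r) (jump s + w s) (jump t)
  <= C * hpow tau (Rabs (jump t - (jump s + w s))).
Proof.
  intros Hst. unfold taylor_error.
  destruct (lift_left t) as [-> _]. destruct (lift_right s) as [-> ->].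
  pose proof (jump_lt s t Hst) as Hpos.
  set (d := jump t - (jump s + w s)). rewrite (Rabs_pos_eq d) by (unfold d; lra).
  assert (Hd : 0 < d) by (unfold d; lra).
  assert (Ed : d = slope * (t - s) + mass_oo s t) by (apply jump_diff; auto).
  assert (Er : jump (t + r) - (jump (s + r) + w (s + r))
               = slope * (t - s) + mass_oo (s + r) (t + r)).
  { rewrite jump_diff by lra. f_equal. ring. }
  rewrite Er. rewrite mass_oo_translate.
  replace (slope * (t - s) + mass (fun p => w (p + r)) (fun p => s < p < t) - 1 * d)
    with (mass (fun p => w (p + r)) (fun p => s < p < t) - mass_oo s t) by lra.
  pose proof slope_ge.
  assert (Hmd : mass_oo s t <= d) by nra.
  assert (Hw : forall L, NoDup L -> (forall p, In p L -> s < p < t) ->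
    lsum w L <= mass_oo s t).
  { intros L H1 H2. apply mass_ub; auto. apply summable_oo. }
  set (e := C * Rpower d tau).
  assert (He : 0 <= e) by (pose proof (Rpower_pos d tau); unfold e; nra).
  assert (Hterm : forall L p, NoDup L -> (forall p, In p L -> s < p < t) -> In p L ->
    Rabs (w (p + r) - w p) <= e * w p).
  { intros L p H1 H2 Hp. eapply Rle_trans; [apply w_holder|].
    destruct (w_ge0 p) as [Hwp|Hwp]; [|rewrite <- Hwp; unfold hpow; lra].
    assert (w p <= d).
    { apply Rle_trans with (2 := Hmd), Rle_trans with (2 := Hw L H1 H2).
      apply lsum_term; auto. }
    unfold e, hpow.
    replace (C * Rpower d tau * w p) with (C * (w p * Rpower d tau)) by ring.
    apply Rmult_le_compat_l; auto. apply Rmult_le_compat_l; [lra|].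
    apply Rle_Rpower_l; lra. }
  (* This bound also witnesses the summability of the translated weight used in [Lo]. *)
  assert (Hup : forall L, NoDup L -> (forall p, In p L -> s < p < t) ->
    lsum (fun p => w (p + r)) L <= (1 + e) * mass_oo s t).
  { intros L H1 H2. apply Rle_trans with (lsum (fun p => (1 + e) * w p) L).
    - apply lsum_le. intros p Hp. pose proof (Hterm L p H1 H2 Hp) as H'.
      apply Rabs_le_between in H'. lra.
    - rewrite lsum_scal. apply Rmult_le_compat_l; [lra | auto]. }
  assert (U : mass (fun p => w (p + r)) (fun p => s < p < t) <= (1 + e) * mass_oo s t)
    by (apply mass_least; auto).
  assert (Lo : mass_oo s t <= mass (fun p => w (p + r)) (fun p => s < p < t)
                             + e * mass_oo s t).
  { apply mass_least. intros L H1 H2.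
    apply Rle_trans with (lsum (fun p => w (p + r)) L + lsum (fun p => e * w p) L).
    - assert (Hd2 : lsum w L - lsum (fun p => e * w p) L <= lsum (fun p => w (p + r)) L).
      { rewrite lsum_scal. replace (lsum w L - e * lsum w L)
          with ((1 - e) * lsum w L) by ring. rewrite <- lsum_scal.
        apply lsum_le. intros p Hp. pose proof (Hterm L p H1 H2 Hp) as H'.
        apply Rabs_le_between in H'. lra. }
      lra.
    - apply Rplus_le_compat.
      + apply mass_ub; auto. eexists. exact Hup.
      + rewrite lsum_scal. apply Rmult_le_compat_l; auto. }
  apply Rle_trans with (e * mass_oo s t).
  - apply Rabs_le. lra.
  - unfold hpow. replace (C * (d * Rpower d tau)) with (e * d) by (unfold e; ring).
    apply Rmult_le_compat_l; auto.
Qed.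

Lemma lift_taylor x y :
  taylor_error (lift r) (lift_deriv r) x y <= 5 * K * hpow tau (Rabs (y - x)).
Proof.
  pose proof C_le_K as HCK.
  assert (H : forall s t x y, in_gap s x -> in_gap t y -> s < t ->
    taylor_error (lift r) (lift_deriv r) x y <= 5 * K * hpow tau (Rabs (y - x)) /\
    taylor_error (lift r) (lift_deriv r) y x <= 5 * K * hpow tau (Rabs (y - x))).
  { clear x y. intros s t x y Hx Hy Hst.
    assert (H1 : in_gap s (jump s + w s)) by (unfold in_gap; pose proof (w_ge0 s); lra).
    assert (H2 : in_gap t (jump t)) by (unfold in_gap; pose proof (w_ge0 t); lra).
    pose proof (jump_lt s t Hst).
    apply taylor_chain with (jump s + w s) (jump t); try (apply lift_taylor_gap with s; assumption);
      try (apply lift_taylor_gap with t; assumption); unfold in_gap in *; try lra.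
    - apply lift_right.
    - apply lift_left.
    - eapply Rle_trans; [apply lift_taylor_across; auto|].
      apply Rmult_le_compat_r; [apply hpow_ge0, Rabs_pos | auto]. }
  pose proof (collapse_spec x) as Hx. pose proof (collapse_spec y) as Hy.
  destruct (Rtotal_order (collapse x) (collapse y)) as [Hl|[E|Hl]].
  - apply (H _ _ x y Hx Hy Hl).
  - rewrite E in Hx. eapply Rle_trans; [apply (lift_taylor_gap _ _ _ Hx Hy)|].
    apply Rmult_le_compat_r; [apply hpow_ge0, Rabs_pos | lra].
  - rewrite Rabs_minus_sym. apply (H _ _ y x Hy Hx Hl).
Qed.

Lemma lift_is_derive x : is_derive (lift r) x (lift_deriv r x).
Proof.
  pose proof C_le_K.
  apply taylor_is_derive with (tau := tau) (C := 5 * K); [lra | lra | apply lift_taylor].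
Qed.

Lemma lift_Derive x : Derive (lift r) x = lift_deriv r x.
Proof. apply is_derive_unique, lift_is_derive. Qed.

Lemma lift_holder : holder_deriv tau (lift r).
Proof.
  exists (2 * (5 * K)). intros x y Hxy. rewrite !lift_Derive.
  pose proof C_le_K.
  apply taylor_holder with (lift r); auto; apply lift_taylor.
Qed.

Lemma lift_diffeo : circle_diffeo_lift (lift r).
Proof.
  split; [apply lift_succ|]. split; [intros x; eexists; apply lift_is_derive|].
  split; [|intros x; rewrite lift_Derive; apply lift_deriv_pos, ratio_invariant].
  intros x. destruct lift_holder as [D HD].
  apply continuity_pt_filterlim. intros eps Heps.
  (* The Hoelder constant comes without a sign, whence the absolute value. *)
  set (eta := eps / (Rabs D + 1)).
  pose proof (Rabs_pos D). pose proof (Rle_abs D).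
  assert (Heta : 0 < eta) by (apply Rdiv_lt_0_compat; lra).
  exists (Rpower eta (/ tau)). split; [apply Rpower_pos|].
  intros y [[_ Hne] Hd]. simpl in *. unfold R_dist, Rdist in *.
  eapply Rle_lt_trans; [apply HD; auto|].
  assert (Hr : Rpower (Rabs (y - x)) tau < eta).
  { replace eta with (Rpower (Rpower eta (/ tau)) tau).
    - apply Rlt_Rpower_l; [lra|]. split; auto. apply Rabs_pos_lt. lra.
    - rewrite Rpower_mult, Rinv_l, Rpower_1 by lra. reflexivity. }
  replace eps with (Rabs D * eta + eta) by (unfold eta; field; lra).
  pose proof (Rpower_pos (Rabs (y - x)) tau). nra.
Qed.

End LiftRegularity.

Lemma iter_lift_in_gap r t x n : invariant r -> in_gap t x ->
  in_gap (t + INR n * r) (Nat.iter n (lift r) x).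
Proof.
  intros Hr Hx. rewrite <- (collapse_unique t x Hx), <- collapse_iter_lift by auto.
  apply collapse_spec.
Qed.

Lemma lift_not_conj_to_rotation r t : invariant r -> 0 < w t ->
  (forall eps, 0 < eps -> exists n, w (t + INR n * r) < eps) ->
  ~ conj_to_rotation (lift r).
Proof.
  (* The bound 1/2 keeps the two ends of the gap distinct on the circle. *)
  intros Hr Hw Hsmall. pose proof (w_le_half t).
  apply proximal_not_conj_to_rotation with (jump t) (jump t + w t); [lra|].
  intros eps He. destruct (Hsmall eps He) as [n Hn]. exists n.
  pose proof (iter_lift_in_gap r t (jump t) n Hr) as H1.
  pose proof (iter_lift_in_gap r t (jump t + w t) n Hr) as H2.
  unfold in_gap in *. apply Rabs_lt_between. lra.
Qed.

End Blowup.

(** * The weight on an orbit of the action *)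

Lemma sumR_le n a b : (forall j, (j < n)%nat -> a j <= b j) -> sumR n a <= sumR n b.
Proof.
  induction n as [|n IH]; simpl; intros H; [lra|].
  apply Rplus_le_compat; [apply IH; intros; apply H; lia | apply H; lia].
Qed.

Lemma sumR_ext n a b : (forall j, (j < n)%nat -> a j = b j) -> sumR n a = sumR n b.
Proof. intros H. apply Rle_antisym; apply sumR_le; intros j Hj; rewrite H; auto; lra. Qed.

Lemma sumR_scal n c a : sumR n (fun j => c * a j) = c * sumR n a.
Proof. induction n as [|n IH]; simpl; [ring | rewrite IH; ring]. Qed.

Lemma sumR_minus n a b : sumR n (fun j => a j - b j) = sumR n a - sumR n b.
Proof. induction n as [|n IH]; simpl; [ring | rewrite IH; ring]. Qed.

Lemma sumR_0 n a : (forall j, (j < n)%nat -> a j = 0) -> sumR n a = 0.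
Proof.
  induction n as [|n IH]; simpl; intros H; [reflexivity|].
  rewrite IH by (intros; apply H; lia). rewrite H by lia. ring.
Qed.

Lemma sumR_single n a k : (k < n)%nat -> (forall j, j <> k -> a j = 0) -> sumR n a = a k.
Proof.
  induction n as [|n IH]; simpl; intros Hk H; [lia|].
  destruct (Nat.eq_dec k n) as [->|Hne].
  - rewrite sumR_0; [ring|]. intros j Hj. apply H. lia.
  - rewrite IH by (auto; lia). rewrite (H n) by lia. ring.
Qed.

Lemma sumR_term n a k : (forall j, (j < n)%nat -> 0 <= a j) -> (k < n)%nat -> a k <= sumR n a.
Proof.
  intros Ha Hk.
  assert (E : sumR n (fun j => if Nat.eq_dec j k then a j else 0) = a k).
  { rewrite (sumR_single n _ k Hk).
    - destruct (Nat.eq_dec k k); [reflexivity | contradiction].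
    - intros j Hj. destruct (Nat.eq_dec j k); [contradiction | reflexivity]. }
  rewrite <- E. apply sumR_le. intros j Hj. destruct (Nat.eq_dec j k); [lra | auto].
Qed.

Lemma Q2R_inject_Z z : Q2R (inject_Z z) = IZR z.
Proof. unfold Q2R, inject_Z. simpl. field. Qed.

Lemma Rpower_ge1 x y : 1 <= x -> 0 <= y -> 1 <= Rpower x y.
Proof. intros Hx Hy. rewrite <- (Rpower_O x) by lra. apply Rle_Rpower; auto. Qed.

(** * Power inequalities and sums over the integer lattice *)

Definition bracket (z : Z) := 1 + Rabs (IZR z).

Lemma bracket_ge1 z : 1 <= bracket z.
Proof. unfold bracket. pose proof (Rabs_pos (IZR z)). lra. Qed.

Lemma bracket_succ z : Rabs (bracket (z + 1) - bracket z) <= 1.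
Proof.
  unfold bracket. rewrite plus_IZR.
  replace (1 + Rabs (IZR z + 1) - (1 + Rabs (IZR z)))
    with (Rabs (IZR z + 1) - Rabs (IZR z)) by ring.
  eapply Rle_trans; [apply Rabs_triang_inv2|].
  replace (IZR z + 1 - IZR z) with 1 by ring. rewrite Rabs_R1. lra.
Qed.

(** Mean value theorem: the derivative is nondecreasing since beta >= 1, and both points are at most
    x + 1 <= 2 x. *)
Lemma Rpower_diff_le x y beta : 1 <= beta -> 1 <= x -> 1 <= y -> Rabs (y - x) <= 1 ->
  Rabs (Rpower y beta - Rpower x beta) <= beta * Rpower (2 * x) (beta - 1).
Proof.
  assert (H : forall a b c, 1 <= beta -> 1 <= a -> a <= b <= a + 1 -> b <= c ->
    0 <= Rpower b beta - Rpower a beta <= beta * Rpower c (beta - 1)).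
  { intros a b c Hbeta Ha [[Hab| ->] Hb] Hc.
    2: { rewrite Rminus_diag. pose proof (Rpower_pos c (beta - 1)). nra. }
    destruct (MVT_cor2 (fun z => Rpower z beta) (fun z => beta * Rpower z (beta - 1)) a b Hab)
      as (m & E & Hm).
    { intros z Hz. apply derivable_pt_lim_power. lra. }
    rewrite E. pose proof (Rpower_pos m (beta - 1)).
    assert (Rpower m (beta - 1) <= Rpower c (beta - 1)) by (apply Rle_Rpower_l; lra).
    split; [apply Rmult_le_pos; nra|].
    replace (beta * Rpower c (beta - 1)) with (beta * Rpower c (beta - 1) * 1) by ring.
    apply Rmult_le_compat; nra. }
  intros Hbeta Hx Hy Hxy. apply Rabs_le_between in Hxy.
  destruct (Rle_lt_dec x y).
  - apply Rabs_le. pose proof (H x y (2 * x)). lra.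
  - rewrite Rabs_minus_sym. apply Rabs_le. pose proof (H y x (2 * x)). lra.
Qed.

(** Integral test in telescoping form: by the mean value theorem each term after the first is at
    most the drop of x^(-s) / s over the preceding unit interval. *)
Lemma lsum_power_le s N : 0 < s ->
  lsum (fun k => Rpower (1 + INR k) (- (1 + s))) (seq 0 (S N)) <= 1 + / s.
Proof.
  intros Hs.
  assert (H : lsum (fun k => Rpower (1 + INR k) (- (1 + s))) (seq 0 (S N))
              <= 1 + (1 - Rpower (1 + INR N) (- s)) * / s).
  { induction N as [|N IH].
    - simpl. rewrite !Rplus_0_r. unfold Rpower. rewrite ln_1, !Rmult_0_r, exp_0. lra.
    - rewrite seq_S, lsum_app, Nat.add_0_l. unfold lsum at 2, fold_right.
      rewrite S_INR, Rplus_0_r.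
      set (x := 1 + INR N) in *. replace (1 + (INR N + 1)) with (x + 1) by (unfold x; ring).
      assert (Hx : 1 <= x) by (unfold x; pose proof (pos_INR N); lra).
      destruct (MVT_cor2 (fun z => Rpower z (- s)) (fun z => - s * Rpower z (- s - 1)) x (x + 1))
        as (m & E & Hm); [lra| |].
      { intros z Hz. apply derivable_pt_lim_power. lra. }
      replace (- s - 1) with (- (1 + s)) in E by ring.
      assert (Hp : Rpower (x + 1) (- (1 + s)) <= Rpower m (- (1 + s))).
      { rewrite !Rpower_Ropp. apply Rinv_le_contravar; [apply Rpower_pos|].
        apply Rle_Rpower_l; lra. }
      replace (1 + (1 - Rpower (x + 1) (- s)) * / s)
        with (1 + (1 - Rpower x (- s)) * / s - (Rpower (x + 1) (- s) - Rpower x (- s)) * / s)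
        by ring.
      rewrite E. replace (- s * Rpower m (- (1 + s)) * (x + 1 - x) * / s)
        with (- Rpower m (- (1 + s))) by (field; lra). lra. }
  eapply Rle_trans; [exact H|].
  assert (0 < / s) by (apply Rinv_0_lt_compat; lra).
  pose proof (Rpower_pos (1 + INR N) (- s)). nra.
Qed.

Definition lprod {A : Type} (c : A -> R) (l : list A) : R :=
  fold_right (fun z p => c z * p) 1 l.

Lemma lprod_app {A} (c : A -> R) l l' : lprod c (l ++ l') = lprod c l * lprod c l'.
Proof. induction l as [|a l IH]; simpl; [ring | rewrite IH; ring]. Qed.

Lemma lprod_ge0 {A} (c : A -> R) l : (forall z, 0 <= c z) -> 0 <= lprod c l.
Proof. intros Hc. induction l as [|a l IH]; simpl; [lra | apply Rmult_le_pos; auto]. Qed.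

(** Multi-indices become lists here: unlike functions on [nat], lists have no irrelevant
    coordinates, so [NoDup] is meaningful for them. *)
Fixpoint box {A : Type} (zs : list A) (n : nat) : list (list A) :=
  match n with
  | O => nil :: nil
  | S n => flat_map (fun z => map (cons z) (box zs n)) zs
  end.

Lemma lsum_box {A} (c : A -> R) zs n : lsum (lprod c) (box zs n) = lsum c zs ^ n.
Proof.
  induction n as [|n IH]; simpl; [ring|]. rewrite <- IH. clear IH.
  generalize (box zs n) as b. intros b. induction zs as [|z zs IHz]; simpl; [ring|].
  rewrite lsum_app, lsum_map, IHz. simpl. rewrite lsum_scal. ring.
Qed.

Lemma in_box {A} (zs l : list A) : incl l zs -> In l (box zs (length l)).
Proof.
  induction l as [|z l IH]; simpl; intros H; [auto|].
  apply in_flat_map. exists z. split; [apply H; left; reflexivity|].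
  apply in_map, IH. intros y Hy. apply H. right. exact Hy.
Qed.

(** The repetition of 0 is harmless: the list only serves to bound sums from above. *)
Definition zrange (N : nat) : list Z :=
  map Z.of_nat (seq 0 (S N)) ++ map (fun k => (- Z.of_nat k)%Z) (seq 0 (S N)).

Lemma in_zrange z N : (Z.abs_nat z <= N)%nat -> In z (zrange N).
Proof.
  intros H. apply in_or_app. destruct (Z_le_gt_dec 0 z).
  - left. apply in_map_iff. exists (Z.abs_nat z). split; [lia|]. apply in_seq. lia.
  - right. apply in_map_iff. exists (Z.abs_nat z). split; [lia|]. apply in_seq. lia.
Qed.

Lemma incl_zrange (l : list Z) : exists N, forall M, (N <= M)%nat -> incl l (zrange M).
Proof.
  induction l as [|z l [N IH]].
  - exists 0%nat. intros M _ y [].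
  - exists (Nat.max (Z.abs_nat z) N). intros M HM y [<-|Hy].
    + apply in_zrange. lia.
    + apply (IH M); [lia | exact Hy].
Qed.

Lemma lists_incl_zrange (L : list (list Z)) : exists N, forall l, In l L -> incl l (zrange N).
Proof.
  assert (H : exists N, forall M, (N <= M)%nat -> forall l, In l L -> incl l (zrange M)).
  { induction L as [|l L [N IH]].
    - exists 0%nat. intros M _ l [].
    - destruct (incl_zrange l) as [N' HN']. exists (Nat.max N N').
      intros M HM l' [<-|Hl'].
      + apply HN'. lia.
      + apply IH; [lia | exact Hl']. }
  destruct H as [N HN]. exists N. apply HN. lia.
Qed.

Lemma lsum_zrange_le s N : 0 < s ->
  lsum (fun z => Rpower (bracket z) (- (1 + s))) (zrange N) <= 2 * (1 + / s).
Proof.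
  intros Hs. unfold zrange. rewrite lsum_app, !lsum_map.
  pose proof (lsum_power_le s N Hs) as H.
  assert (E : forall g : nat -> Z, (forall k, bracket (g k) = 1 + INR k) ->
    lsum (fun k => Rpower (bracket (g k)) (- (1 + s))) (seq 0 (S N)) <= 1 + / s).
  { intros g Hg. eapply Rle_trans; [|exact H]. apply lsum_le. intros k _.
    rewrite Hg. lra. }
  pose proof (E Z.of_nat) as E1. pose proof (E (fun k => (- Z.of_nat k)%Z)) as E2.
  rewrite <- Rplus_diag. apply Rplus_le_compat; [apply E1 | apply E2]; intros k; unfold bracket.
  - rewrite <- INR_IZR_INZ, Rabs_pos_eq by apply pos_INR. reflexivity.
  - rewrite opp_IZR, Rabs_Ropp, <- INR_IZR_INZ, Rabs_pos_eq by apply pos_INR. reflexivity.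
Qed.

Section Weight.

Variables (d : nat) (tau rho : nat -> R).
Hypothesis Hd : (2 <= d)%nat.
Hypothesis Htau : forall k, (k < d)%nat -> 0 < tau k < 1.
Hypothesis Hsum : sumR d tau < 1.
Hypothesis Hrho : rat_independent d rho.

Definition angle (i : nat -> Z) := sumR d (fun j => IZR (i j) * rho j).

Definition size (i : nat -> Z) := sumR d (fun j => Rpower (bracket (i j)) (/ tau j)).

(** The difference of the two sides is an integral combination of the [rho j] equal to an integer.
    Only the first [d] coordinates are determined, and only those enter [size]. *)
Lemma angle_inj i i' n n' : angle i + IZR n = angle i' + IZR n' ->
  forall j, (j < d)%nat -> i j = i' j.
Proof.
  intros E. apply NNPP. intros HN.
  apply (Hrho (fun j => inject_Z (i j - i' j)) ) with (p := inject_Z (n' - n)).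
  - apply NNPP. intros HN'. apply HN. intros j Hj. apply NNPP. intros Hne.
    apply HN'. exists j. split; auto. unfold Qeq. simpl. lia.
  - rewrite Q2R_inject_Z, minus_IZR.
    rewrite (sumR_ext _ _ (fun j => IZR (i j) * rho j - IZR (i' j) * rho j)).
    + rewrite sumR_minus. unfold angle in E. lra.
    + intros j _. rewrite Q2R_inject_Z, minus_IZR. ring.
Qed.

Lemma size_ext i i' : (forall j, (j < d)%nat -> i j = i' j) -> size i = size i'.
Proof. intros H. apply sumR_ext. intros j Hj. rewrite H; auto. Qed.

Lemma size_term i j : (j < d)%nat -> Rpower (bracket (i j)) (/ tau j) <= size i.
Proof.
  intros Hj. apply (sumR_term d (fun j => Rpower (bracket (i j)) (/ tau j))); auto.
  intros k _. left. apply Rpower_pos.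
Qed.

Lemma inv_tau_ge1 j : (j < d)%nat -> 1 <= / tau j.
Proof.
  intros Hj. destruct (Htau j Hj). rewrite <- Rinv_1. apply Rinv_le_contravar; lra.
Qed.

Lemma bracket_le_size i j : (j < d)%nat -> bracket (i j) <= size i.
Proof.
  intros Hj. apply Rle_trans with (2 := size_term i j Hj).
  pose proof (bracket_ge1 (i j)).
  rewrite <- (Rpower_1 (bracket (i j))) at 1 by lra.
  apply Rle_Rpower; [lra | apply inv_tau_ge1; auto].
Qed.

Lemma size_ge1 i : 1 <= size i.
Proof.
  apply Rle_trans with (2 := bracket_le_size i 0 ltac:(lia)). apply bracket_ge1.
Qed.

Lemma bracket_le_power_size i j : (j < d)%nat -> bracket (i j) <= Rpower (size i) (tau j).
Proof.
  intros Hj. destruct (Htau j Hj). pose proof (bracket_ge1 (i j)).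
  replace (bracket (i j)) with (Rpower (Rpower (bracket (i j)) (/ tau j)) (tau j)).
  - apply Rle_Rpower_l; [lra|]. split; [apply Rpower_pos | apply size_term; auto].
  - rewrite Rpower_mult, Rinv_l, Rpower_1; lra.
Qed.

(** The margin by which the exponent of the product bound exceeds 1; its positivity is the
    hypothesis on the sum of the [tau j]. *)
Definition excess := / sumR d tau - 1.

Lemma sum_tau_pos : 0 < sumR d tau.
Proof.
  apply Rlt_le_trans with (tau 0%nat); [apply Htau; lia|].
  apply sumR_term; [|lia]. intros j Hj. left. apply Htau. exact Hj.
Qed.

Lemma excess_pos : 0 < excess.
Proof.
  unfold excess. pose proof sum_tau_pos.
  assert (1 < / sumR d tau); [|lra].
  rewrite <- Rinv_1. apply Rinv_lt_contravar; lra.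
Qed.

Definition coef z := Rpower (bracket z) (- (1 + excess)).

(** Since (1 + excess) times the sum of the [tau j] is 1, the inverse of size splits into the
    factors size^(-(1 + excess) tau_j), and bracket(i_j) <= size^(tau_j). The induction runs over
    prefixes of the coordinates. *)
Lemma inv_size_le i : / size i <= lprod coef (map i (seq 0 d)).
Proof.
  assert (H : forall n, (n <= d)%nat ->
    Rpower (size i) (- ((1 + excess) * sumR n tau)) <= lprod coef (map i (seq 0 n))).
  { induction n as [|n IH]; intros Hn.
    - simpl. rewrite Rmult_0_r, Ropp_0, Rpower_O; [lra|]. pose proof (size_ge1 i). lra.
    - rewrite seq_S, map_app, lprod_app. simpl.
      replace (- ((1 + excess) * (sumR n tau + tau n)))
        with (- ((1 + excess) * sumR n tau) + - (tau n * (1 + excess))) by ring.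
      rewrite Rpower_plus, Rmult_1_r.
      apply Rmult_le_compat; try (left; apply Rpower_pos); [apply IH; lia|].
      unfold coef. rewrite !Rpower_Ropp, <- Rpower_mult.
      apply Rinv_le_contravar; [apply Rpower_pos|]. pose proof excess_pos.
      apply Rle_Rpower_l; [lra|]. pose proof (bracket_ge1 (i n)).
      split; [lra | apply bracket_le_power_size; lia]. }
  specialize (H d (le_n d)). pose proof sum_tau_pos.
  replace ((1 + excess) * sumR d tau) with 1 in H by (unfold excess; field; lra).
  rewrite Rpower_Ropp, Rpower_1 in H; auto. pose proof (size_ge1 i). lra.
Qed.

(** 2 (1 + 1/excess) bounds the sum of [coef] over the integers and its d-th power the sum over the
    lattice; the outer 2 brings the total down to 1/2. *)
Definition scale := / (2 * (2 * (1 + / excess)) ^ d).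

Lemma scale_den_pos : 0 < (2 * (1 + / excess)) ^ d.
Proof.
  apply pow_lt. pose proof (Rinv_0_lt_compat _ excess_pos). lra.
Qed.

Lemma scale_pos : 0 < scale.
Proof. apply Rinv_0_lt_compat. pose proof scale_den_pos. lra. Qed.

Lemma lsum_lprod_le (L : list (list Z)) : NoDup L -> (forall l, In l L -> length l = d) ->
  scale * lsum (lprod coef) L <= 1 / 2.
Proof.
  intros HL Hlen. destruct (lists_incl_zrange L) as [N HN].
  assert (Hc : forall z, 0 <= coef z) by (intros z; left; apply Rpower_pos).
  apply Rle_trans with (scale * (2 * (1 + / excess)) ^ d).
  - apply Rmult_le_compat_l; [left; apply scale_pos|].
    apply Rle_trans with (lsum (lprod coef) (box (zrange N) d)).
    + apply lsum_incl; auto.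
      * intros l _. apply lprod_ge0, Hc.
      * intros l Hl. rewrite <- (Hlen l Hl). apply in_box, HN, Hl.
    + rewrite lsum_box. apply pow_incr. split.
      * apply lsum_ge0. intros z _. apply Hc.
      * apply lsum_zrange_le, excess_pos.
  - unfold scale. pose proof scale_den_pos. right. field. lra.
Qed.

(** * The weight as a function on the line *)

Definition on_orbit t := exists i n, t = angle i + IZR n.

Definition orbit_index t := epsilon (inhabits (fun _ : nat => 0%Z))
  (fun i => exists n, t = angle i + IZR n).

Definition weight t :=
  if excluded_middle_informative (on_orbit t) then scale / size (orbit_index t) else 0.

Lemma orbit_index_spec t : on_orbit t -> exists n, t = angle (orbit_index t) + IZR n.
Proof. intros H. apply (epsilon_spec _ (fun i => exists n, t = angle i + IZR n)), H. Qed.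

Lemma weight_orbit i n : weight (angle i + IZR n) = scale / size i.
Proof.
  unfold weight. destruct (excluded_middle_informative _) as [H|H].
  - destruct (orbit_index_spec _ H) as [m Hm]. f_equal.
    apply size_ext. intros j Hj. symmetry. apply (angle_inj _ _ _ _ Hm). exact Hj.
  - exfalso. apply H. exists i, n. reflexivity.
Qed.

Lemma weight_off t : ~ on_orbit t -> weight t = 0.
Proof. intros H. unfold weight. destruct (excluded_middle_informative _); tauto. Qed.

Lemma weight_ge0 t : 0 <= weight t.
Proof.
  unfold weight. destruct (excluded_middle_informative _); [|lra].
  pose proof (size_ge1 (orbit_index t)). pose proof scale_pos.
  left. apply Rdiv_lt_0_compat; lra.
Qed.

Definition shift k (z : Z) (i : nat -> Z) j := if Nat.eq_dec j k then (i j + z)%Z else i j.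

Lemma angle_shift k z i : (k < d)%nat -> angle (shift k z i) = angle i + IZR z * rho k.
Proof.
  intros Hk. unfold angle.
  apply Rplus_eq_reg_r with (- sumR d (fun j => IZR (i j) * rho j)).
  change (sumR d (fun j => IZR (shift k z i j) * rho j) - sumR d (fun j => IZR (i j) * rho j)
    = sumR d (fun j => IZR (i j) * rho j) + IZR z * rho k - sumR d (fun j => IZR (i j) * rho j)).
  rewrite <- sumR_minus, (sumR_single _ _ k Hk).
  - unfold shift. destruct (Nat.eq_dec k k); [|contradiction]. rewrite plus_IZR. ring.
  - intros j Hj. unfold shift. destruct (Nat.eq_dec j k); [contradiction | ring].
Qed.

Lemma on_orbit_shift k z t : (k < d)%nat -> on_orbit t -> on_orbit (t + IZR z * rho k).
Proof.
  intros Hk (i & n & ->). exists (shift k z i), n. rewrite angle_shift by auto. ring.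
Qed.

Lemma weight_succ t : weight (t + 1) = weight t.
Proof.
  destruct (classic (on_orbit t)) as [(i & n & ->)|H].
  - replace (angle i + IZR n + 1) with (angle i + IZR (n + 1)) by (rewrite plus_IZR; ring).
    rewrite !weight_orbit. reflexivity.
  - rewrite !weight_off; auto. intros (i & n & E). apply H. exists i, (n - 1)%Z.
    rewrite minus_IZR. lra.
Qed.

(** Points off the orbit weigh nothing. Two orbit points of [0, 1) with the same index vector differ
    by an integer, hence coincide, so the sum is dominated by one over distinct vectors. *)
Lemma weight_total L : NoDup L -> (forall p, In p L -> 0 <= p < 1) -> lsum weight L <= 1 / 2.
Proof.
  intros HL H01.
  destruct (lsum_partition weight on_orbit L HL) as (L1 & L2 & N1 & N2 & H1 & H2 & ->).
  assert (E2 : lsum weight L2 <= 0).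
  { clear - H2. induction L2 as [|p L2 IH]; simpl; [lra|].
    rewrite weight_off by (apply H2; left; reflexivity).
    assert (lsum weight L2 <= 0); [|lra]. apply IH. intros q Hq. apply H2. right. exact Hq. }
  set (vec := fun t => map (orbit_index t) (seq 0 d)).
  assert (E1 : lsum weight L1 <= scale * lsum (lprod coef) (map vec L1)).
  { rewrite lsum_map, <- lsum_scal. apply lsum_le. intros p Hp.
    destruct (orbit_index_spec p) as [n Hn]; [apply H1; exact Hp|].
    rewrite Hn at 1. rewrite weight_orbit. apply Rmult_le_compat_l; [left; apply scale_pos|].
    apply inv_size_le. }
  assert (E3 : scale * lsum (lprod coef) (map vec L1) <= 1 / 2); [|lra].
  apply lsum_lprod_le.
  - apply NoDup_map_NoDup_ForallPairs; auto. intros p q Hp Hq E.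
    destruct (H1 p Hp) as [Hp1 Op]. destruct (H1 q Hq) as [Hq1 Oq].
    destruct (orbit_index_spec p Op) as [n Hn]. destruct (orbit_index_spec q Oq) as [m Hm].
    assert (Ea : angle (orbit_index p) = angle (orbit_index q)).
    { apply sumR_ext. intros j Hj. do 2 f_equal. unfold vec in E.
      apply (ext_in_map E). apply in_seq. lia. }
    apply H01 in Hp1, Hq1.
    assert (A1 : IZR n < IZR m + 1) by lra. assert (A2 : IZR m < IZR n + 1) by lra.
    rewrite <- plus_IZR in A1, A2. apply lt_IZR in A1, A2.
    assert (n = m) by lia. subst. lra.
  - intros l Hl. apply in_map_iff in Hl. destruct Hl as (t & <- & _).
    unfold vec. rewrite length_map, length_seq. reflexivity.
Qed.

Lemma bracket_shift_le k z i j : (Z.abs z <= 1)%Z ->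
  Rabs (bracket (shift k z i j) - bracket (i j)) <= 1.
Proof.
  intros Hz. unfold shift. destruct (Nat.eq_dec j k).
  - assert (z = 1 \/ z = 0 \/ z = -1)%Z as [->|[->| ->]] by lia.
    + apply bracket_succ.
    + rewrite Z.add_0_r, Rminus_diag, Rabs_R0. lra.
    + rewrite Rabs_minus_sym. replace (i j) with (i j + -1 + 1)%Z at 1 by lia.
      apply bracket_succ.
  - rewrite Rminus_diag, Rabs_R0. lra.
Qed.

Lemma shift_shift k z i j : shift k (- z) (shift k z i) j = i j.
Proof. unfold shift. destruct (Nat.eq_dec j k); lia. Qed.

(** * Effect of one step along a coordinate axis *)

Section Direction.

Variable k : nat.
Hypothesis Hk : (k < d)%nat.

Let beta := / tau k.
Let D := Rpower 2 beta.

(** A bracket is at least 1, so a unit step at most doubles it; the power 1 / tau_k turns 2 into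
    [D]. *)
Lemma size_shift_le z i : (Z.abs z <= 1)%Z -> size (shift k z i) <= D * size i.
Proof.
  intros Hz. unfold size. rewrite <- sumR_scal. apply sumR_le. intros j Hj.
  pose proof (bracket_shift_le k z i j Hz) as H. apply Rabs_le_between in H.
  pose proof (bracket_ge1 (i j)). pose proof (inv_tau_ge1 k Hk).
  pose proof (bracket_ge1 (shift k z i j)). pose proof (inv_tau_ge1 j Hj).
  destruct (Nat.eq_dec j k) as [->|Hne].
  - unfold D, beta. rewrite Rpower_mult_distr by lra. apply Rle_Rpower_l; lra.
  - unfold shift. destruct (Nat.eq_dec j k); [contradiction|].
    pose proof (Rpower_pos (bracket (i j)) (/ tau j)).
    assert (1 <= D) by (apply Rpower_ge1; unfold beta; lra). nra.
Qed.

(** Only the k-th term changes. With x the k-th bracket, the identity beta - 1 = beta (1 - tau_k)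
    rewrites x^(beta - 1) as (x^beta)^(1 - tau_k), and x^beta is a term of [size i]. *)
Lemma size_shift_diff i :
  Rabs (size (shift k 1 i) - size i) <= beta * D * Rpower (size i) (1 - tau k).
Proof.
  pose proof (inv_tau_ge1 k Hk) as Hb. destruct (Htau k Hk) as [Ht0 Ht1].
  unfold size at 1 2. rewrite <- sumR_minus, (sumR_single _ _ k Hk).
  2: { intros j Hj. unfold shift. destruct (Nat.eq_dec j k); [contradiction | ring]. }
  pose proof (bracket_ge1 (i k)) as Hx.
  eapply Rle_trans.
  { apply Rpower_diff_le; [exact Hb | exact Hx | apply bracket_ge1 |].
    apply bracket_shift_le. lia. }
  fold beta. rewrite Rmult_assoc. apply Rmult_le_compat_l; [unfold beta; lra|].
  rewrite <- Rpower_mult_distr by lra.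
  apply Rmult_le_compat; try (left; apply Rpower_pos).
  - apply Rle_Rpower; lra.
  - replace (beta - 1) with (beta * (1 - tau k)) by (unfold beta; field; lra).
    rewrite <- Rpower_mult. apply Rle_Rpower_l; [lra|].
    split; [apply Rpower_pos | apply size_term; auto].
Qed.

Lemma weight_translate_orbit i n :
  weight (angle i + IZR n + rho k) = scale / size (shift k 1 i).
Proof.
  rewrite <- (weight_orbit _ n), angle_shift by auto. f_equal. ring.
Qed.

Lemma weight_translate_off t : ~ on_orbit t -> weight (t + rho k) = 0.
Proof.
  intros H. apply weight_off. intros H'. apply H.
  replace t with (t + rho k + IZR (-1) * rho k) by ring.
  apply on_orbit_shift; auto.
Qed.

Lemma weight_ratio t : weight t <= D * weight (t + rho k) /\ weight (t + rho k) <= D * weight t.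
Proof.
  destruct (classic (on_orbit t)) as [(i & n & ->)|H].
  - rewrite weight_translate_orbit, weight_orbit.
    pose proof (size_ge1 i) as S1. pose proof (size_ge1 (shift k 1 i)) as S2.
    pose proof (size_shift_le 1 i ltac:(lia)) as R1.
    pose proof (size_shift_le (-1) (shift k 1 i) ltac:(lia)) as R2.
    rewrite (size_ext (shift k (-1) (shift k 1 i)) i) in R2
      by (intros j _; apply (shift_shift k 1)).
    pose proof scale_pos.
    assert (Hinv : forall a b, 1 <= a -> 1 <= b -> b <= D * a -> scale / a <= D * (scale / b)).
    { intros a b Ha Hb Hab.
      replace (D * (scale / b)) with (scale * (D * / b)) by (field; lra).
      apply Rmult_le_compat_l; [lra|].
      apply Rmult_le_reg_r with (a * b); [nra|].
      replace (/ a * (a * b)) with b by (field; lra).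
      replace (D * / b * (a * b)) with (D * a) by (field; lra). exact Hab. }
    split; apply Hinv; auto.
  - rewrite weight_translate_off, weight_off by auto. lra.
Qed.

Lemma weight_holder t :
  Rabs (weight (t + rho k) - weight t)
  <= beta * D * D / Rpower scale (tau k) * hpow (tau k) (weight t).
Proof.
  destruct (Htau k Hk) as [Ht0 Ht1]. pose proof scale_pos as Hs.
  assert (HD : 0 < D) by apply Rpower_pos.
  destruct (classic (on_orbit t)) as [(i & n & ->)|H].
  - rewrite weight_translate_orbit, weight_orbit.
    pose proof (size_ge1 i) as S1. pose proof (size_ge1 (shift k 1 i)) as S2.
    pose proof (size_shift_diff i) as Hdiff.
    pose proof (size_shift_le (-1) (shift k 1 i) ltac:(lia)) as R2.
    rewrite (size_ext (shift k (-1) (shift k 1 i)) i) in R2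
      by (intros j _; apply (shift_shift k 1)).
    set (m := size i) in *. set (m' := size (shift k 1 i)) in *.
    replace (scale / m' - scale / m) with (- (m' - m) * (scale * / m * / m')) by (field; lra).
    assert (Im : 0 < / m) by (apply Rinv_0_lt_compat; lra).
    assert (Im' : 0 < / m') by (apply Rinv_0_lt_compat; lra).
    assert (Hle : / m' <= D * / m).
    { apply Rmult_le_reg_r with (m * m'); [nra|].
      replace (/ m' * (m * m')) with m by (field; lra).
      replace (D * / m * (m * m')) with (D * m') by (field; lra). exact R2. }
    assert (Hsm : 0 < scale * / m) by nra.
    rewrite Rabs_mult, Rabs_Ropp, (Rabs_pos_eq (scale * / m * / m')) by nra.
    pose proof (Rpower_pos scale (tau k)). pose proof (Rpower_pos m (tau k)).
    (* The bound has order m^(1 - tau_k) / m^2 = (1/m)^(1 + tau_k). The first [D] is that of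
       [size_shift_diff], the second compares m' with m; passing from 1/m to the weight costs the
       division by scale^(tau_k). *)
    apply Rle_trans with (beta * D * Rpower m (1 - tau k) * (scale * / m * (D * / m))).
    + apply Rmult_le_compat; auto using Rabs_pos; [nra|].
      apply Rmult_le_compat_l; lra.
    + right. unfold hpow, Rdiv at 2 3. rewrite <- Rpower_mult_distr by lra.
      replace (Rpower (/ m) (tau k)) with (/ Rpower m (tau k)).
      * unfold Rminus. rewrite Rpower_plus, Rpower_Ropp, Rpower_1 by lra. field. lra.
      * rewrite <- Rpower_Ropp. unfold Rpower. rewrite ln_Rinv by lra. f_equal. ring.
  - rewrite weight_translate_off, weight_off by auto.
    rewrite Rminus_diag, Rabs_R0. unfold hpow. lra.
Qed.

(** After n steps along axis k from the origin the size is at least 1 + n, so any n > scale / eps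
    will do. *)
Lemma weight_orbit_small eps : 0 < eps -> exists n, weight (0 + INR n * rho k) < eps.
Proof.
  intros He. pose proof scale_pos as Hs.
  destruct (INR_unbounded (scale / eps)) as [n Hn]. exists n.
  set (i := shift k (Z.of_nat n) (fun _ => 0%Z)).
  assert (E : 0 + INR n * rho k = angle i + IZR 0).
  { unfold i. rewrite angle_shift, <- INR_IZR_INZ by auto.
    unfold angle. rewrite sumR_0; [ring|]. intros j _. ring. }
  rewrite E, weight_orbit. pose proof (bracket_le_size i k Hk) as H.
  assert (Hb : bracket (i k) = 1 + INR n).
  { unfold bracket, i, shift. destruct (Nat.eq_dec k k); [|contradiction].
    rewrite Z.add_0_l, <- INR_IZR_INZ, Rabs_pos_eq; [reflexivity | apply pos_INR]. }
  rewrite Hb in H. pose proof (pos_INR n).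
  apply Rmult_lt_reg_r with (size i); [lra|].
  replace (scale / size i * size i) with (scale / eps * eps) by (field; lra).
  rewrite (Rmult_comm eps). apply Rmult_lt_compat_r; lra.
Qed.

End Direction.

Lemma weight_0_pos : 0 < weight 0.
Proof.
  assert (E : weight 0 = scale / size (fun _ => 0%Z)).
  { rewrite <- (weight_orbit _ 0). f_equal. unfold angle.
    rewrite sumR_0; [ring|]. intros j _. ring. }
  rewrite E. pose proof scale_pos. pose proof (size_ge1 (fun _ => 0%Z)).
  apply Rdiv_lt_0_compat; lra.
Qed.

End Weight.

Theorem theoremB (d : nat) (tau rho : nat -> R) :
  (2 <= d)%nat ->
  (forall k, (k < d)%nat -> 0 < tau k < 1) ->
  sumR d tau < 1 ->
  rat_independent d rho ->
  exists f : nat -> R -> R,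
    (forall j k, (j < d)%nat -> (k < d)%nat -> circle_commute (f j) (f k)) /\
    (forall k, (k < d)%nat ->
       circle_diffeo_lift (f k) /\ holder_deriv (tau k) (f k) /\
       has_rotation_number (f k) (rho k) /\ ~ conj_to_rotation (f k)).
Proof.
  intros Hd Htau Hsum Hrho.
  set (w := weight d tau rho).
  assert (w0 : forall t, 0 <= w t) by (apply weight_ge0; auto).
  assert (w1 : forall t, w (t + 1) = w t) by (apply weight_succ; auto).
  assert (wT : forall L, NoDup L -> (forall p, In p L -> 0 <= p < 1) -> lsum w L <= 1 / 2)
    by (apply weight_total; auto).
  set (D := fun k => Rpower 2 (/ tau k)).
  set (C := fun k => / tau k * D k * D k / Rpower (scale d tau) (tau k)).
  assert (HD : forall k, (k < d)%nat -> 1 <= D k).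
  { intros k Hk. apply Rpower_ge1; [lra|]. pose proof (inv_tau_ge1 d tau Htau k Hk). lra. }
  assert (HC : forall k, (k < d)%nat -> 0 <= C k).
  { intros k Hk. pose proof (HD k Hk). pose proof (inv_tau_ge1 d tau Htau k Hk).
    pose proof (Rpower_pos (scale d tau) (tau k)).
    apply Rdiv_le_0_compat; auto. apply Rmult_le_pos; [apply Rmult_le_pos|]; lra. }
  assert (Hratio : forall k, (k < d)%nat -> forall t,
    w t <= D k * w (t + rho k) /\ w (t + rho k) <= D k * w t)
    by (intros k Hk; apply weight_ratio; auto).
  assert (Hholder : forall k, (k < d)%nat -> forall t,
    Rabs (w (t + rho k) - w t) <= C k * hpow (tau k) (w t))
    by (intros k Hk; apply weight_holder; auto).
  assert (Hinv : forall k, (k < d)%nat -> invariant w (rho k)).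
  { intros k Hk. apply ratio_invariant with (D k); auto. }
  exists (fun k => lift w (rho k)). split.
  (* The lifts commute exactly on the line, so the integer is 0. *)
  - intros j k Hj Hk x. exists 0%Z. rewrite !lift_lift by auto.
    rewrite (Rplus_comm (rho k)). ring.
  - intros k Hk. split; [|split; [|split]].
    + apply lift_diffeo with (tau k) (D k) (C k); auto.
    + apply lift_holder with (D k) (C k); auto.
    + apply lift_rotation_number; auto.
    + apply lift_not_conj_to_rotation with 0; auto.
      * apply weight_0_pos; auto.
      * intros eps He. apply weight_orbit_small; auto.
Qed.
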